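(* Let $(\mathcal A,\mathbb F,\mathbb I,H)$ be a Cuntz--Krieger type system such that the universal representation $\zeta:\mathbb F/\mathbb I\to C^*(\mathbb F/\mathbb I)$ is injective, and let $\mathbb A$ be its core. Let $\mathbb B$ be any $*$-subalgebra of $\mathbb A$. Then the map $\Phi_{\mathbb B}:\Sigma_{\mathbb B}\to\mathcal I$, $\Phi_{\mathbb B}(I)=\mathcal I(I)$, is injective. Its inverse (on its image) is given by $\Phi_{\mathbb B}^{-1}(D)=D\cap\mathbb B$ for $D\in\Phi_{\mathbb B}(\Sigma_{\mathbb B})\subseteq\mathcal I$. Moreover, for all $I,J\in\Sigma_{\mathbb B}$: $$\Phi_{\mathbb B}(I+J)=\Phi_{\mathbb B}(I)+\Phi_{\mathbb B}(J)\quad\text{if } I+J\in\Sigma_{\mathbb B},$$ $$\Phi_{\mathbb B}(I\cap J)=\Phi_{\mathbb B}(I)\cap\Phi_{\mathbb B}(J)\quad\text{if }\Phi_{\mathbb B}(I)\cap\Phi_{\mathbb B}(J)\in\Phi_{\mathbb B}(\Sigma_{\mathbb B}).$$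
   Context: Setting. $\mathcal A$ is a set (alphabet), $\mathbb F$ is the free nonunital complex $*$-algebra generated by $\mathcal A$, $\mathbb I$ is a two-sided self-adjoint ideal of $\mathbb F$, and $H$ is a closed subgroup of $\mathbb T^{\mathcal A}$ ($\mathbb T$ the circle group). Elements of $\mathbb F$ are also used to denote their classes in $\mathbb F/\mathbb I$. The set of words is $W=\{a_1\cdots a_n\in\mathbb F/\mathbb I : n\ge 1,\ a_i\in\mathcal A\cup\mathcal A^*\}$. A projection in a $*$-algebra is an element $p$ with $p=p^*=p^2$. Property (A): there is an action $t:H\to\mathrm{Aut}(\mathbb F/\mathbb I)$ by $*$-automorphisms (gauge action) with $t_\lambda(a)=\lambda_a a$ for all $a\in\mathcal A$, $\lambda=(\lambda_b)_{b\in\mathcal A}\in H$. Given (A), with $(\hat H,+,0)$ the (additively written) character group of $H$, there is a balance function $\mathrm{bal}:W\setminus\{0\}\to\hat H$ determined by $\mathrm{bal}(a)(\lambda)=\lambda_a$ for $a\in\mathcal A$, $\mathrm{bal}(xy)=\mathrm{bal}(x)+\mathrm{bal}(y)$ and $\mathrm{bal}(x^* )=-\mathrm{bal}(x)$; equivalently $t_\lambda(x)=\mathrm{bal}(x)(\lambda)\,x$ for nonzero words $x$. $W_n$ is the set of (nonzero) words with balance $n\in\hat H$. The core $\mathbb A$ is the linear span of $W_0$ in $\mathbb F/\mathbb I$; it is a $*$-algebra. Property (B): $\mathbb A$ is locally matricial, i.e. for all $x_1,\dots,x_n\in\mathbb A$ there is a finite dimensional $C^*$-subalgebra of $\mathbb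 A$ containing $x_1,\dots,x_n$. Property (C'): for every word $x\in W\setminus W_0$ and every nonzero projection $e\in\mathbb A$ there is a nonzero projection $p\le e$ in $\mathbb A$ with $pxp=0$. $(\mathcal A,\mathbb F,\mathbb I,H)$ is a Cuntz--Krieger type system (and $\mathbb F/\mathbb I$ a Cuntz--Krieger type $*$-algebra) if (A), (B), (C') hold and there is a $*$-homomorphism from $\mathbb F/\mathbb I$ into some $C^*$-algebra that is injective on $\mathbb A$. Then the universal enveloping $C^*$-algebra $C^*(\mathbb F/\mathbb I)$ exists, with universal representation $\zeta:\mathbb F/\mathbb I\to C^*(\mathbb F/\mathbb I)$. When $\zeta$ is injective, $\mathbb F/\mathbb I$ is regarded as a $*$-subalgebra of $C^*(\mathbb F/\mathbb I)$. Ideals. $\Sigma$ is the set of two-sided self-adjoint ideals of $\mathbb F/\mathbb I$; $\mathcal I$ is the set of closed two-sided ideals of $C^*(\mathbb F/\mathbb I)$. For a $*$-subalgebra $\mathbb B\subseteq\mathbb A$, $\Sigma^{\mathbb B}$ is the set of self-adjoint two-sided ideals of $\mathbb B$ and $\Sigma_{\mathbb B}=\{J\cap\mathbb B : J\in\Sigma\}\subseteq\Sigma^{\mathbb B}$. For $X\subseteq\mathbb F/\mathbb I$, $\mathcal I(X)\in\mathcal I$ denotes the closed two-sided ideal of $C^*(\mathbb F/\mathbb I)$ generated by $X$. *)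

(* Defs.v *)
From HB Require Import structures.
From mathcomp Require Import all_boot all_order all_algebra.
From mathcomp Require Import boolp classical_sets functions cardinality.
From mathcomp Require Import reals topology normedtype complex.

Set Implicit Arguments.
Unset Strict Implicit.
Unset Printing Implicit Defensive.

Import Order.TTheory GRing.Theory Num.Theory.
Import numFieldNormedType.Exports.

Local Open Scope quotient_scope.
Local Open Scope classical_set_scope.
Local Open Scope ring_scope.

Reserved Notation "x ** y" (at level 40, left associativity).

(* Algebras are not assumed to be unital, so the ring structures of MathComp
   do not apply.  The scalar field C is instantiated with R[i]. *)
HB.mixin Record Lmodule_isStarAlgebra (C : numClosedFieldType) X
    of GRing.Lmodule C X := {
  amul : X -> X -> X;
  star : X -> X;
  amulA : associative amul;
  amulDl : left_distributive amul +%R;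
  amulDr : right_distributive amul +%R;
  amulZl : forall (a : C) (x y : X), amul (a *: x) y = a *: amul x y;
  amulZr : forall (a : C) (x y : X), amul x (a *: y) = a *: amul x y;
  starD : {morph star : x y / x + y};
  starZ : forall (a : C) (x : X), star (a *: x) = a^* *: star x;
  starM : forall x y, star (amul x y) = amul (star y) (star x);
  starK : involutive star
}.

#[short(type="starAlgType")]
HB.structure Definition StarAlgebra (C : numClosedFieldType) :=
  {X of GRing.Lmodule C X & Lmodule_isStarAlgebra C X}.

Notation "x ** y" := (amul x y) : ring_scope.

HB.mixin Record isCStarNorm (C : numClosedFieldType) X
    of CompleteNormedModule C X & StarAlgebra C X := {
  cstar_normM : forall x y : X, `|x ** y| <= `|x| * `|y|;
  cstar_normS : forall x : X, `|star x ** x| = `|x| ^+ 2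
}.

#[short(type="cstarAlgType")]
HB.structure Definition CStarAlgebra (C : numClosedFieldType) :=
  {X of CompleteNormedModule C X & StarAlgebra C X & isCStarNorm C X}.

Section StarAlgebraNotions.
Variable C : numClosedFieldType.
Implicit Types X Y : starAlgType C.

Definition star_hom X Y (f : X -> Y) : Prop :=
  [/\ linear f, forall x y, f (x ** y) = f x ** f y
    & forall x, f (star x) = star (f x)].

Definition star_aut X (f : X -> X) : Prop := star_hom f /\ bijective f.

Definition subspace X (S : set X) : Prop :=
  S 0 /\ forall (a : C) x y, S x -> S y -> S (a *: x + y).

Definition star_subalgebra X (S : set X) : Prop :=
  [/\ subspace S, forall x y, S x -> S y -> S (x ** y)
    & forall x, S x -> S (star x)].

Definition ideal X (B J : set X) : Prop :=
  [/\ J `<=` B, subspace J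
    & forall b x, B b -> J x -> J (b ** x) /\ J (x ** b)].

Definition star_ideal X (B J : set X) : Prop :=
  ideal B J /\ forall x, J x -> J (star x).

Definition projection X (p : X) : Prop := star p = p /\ p ** p = p.

Definition proj_le X (p e : X) : Prop := p ** e = p.

Definition lspan X (S : set X) : set X :=
  [set x | exists (n : nat) (c : 'I_n -> C) (w : 'I_n -> X),
     (forall i, S (w i)) /\ x = \sum_i c i *: w i].

Definition finite_dim X : Prop :=
  exists S : set X, finite_set S /\ lspan S = setT.

(* A *-subalgebra of X which is a finite dimensional C*-algebra in some norm,
   i.e. a *-isomorphic copy in X of a finite dimensional C*-algebra. *)
Definition fd_cstar_subalgebra X (M : set X) : Prop :=
  exists (D : cstarAlgType C) (f : D -> X),
    [/\ star_hom f, injective f, range f = M & finite_dim D].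

Definition locally_matricial X (S : set X) : Prop :=
  forall (n : nat) (x : 'I_n -> X), (forall i, S (x i)) ->
  exists M : set X,
    [/\ fd_cstar_subalgebra M, M `<=` S & forall i, M (x i)].

Record starIdeal X := StarIdeal {
  starIdeal_set :> set X;
  starIdealP : star_ideal setT starIdeal_set
}.

Definition universal_rep X (U : cstarAlgType C) (zeta : X -> U) : Prop :=
  star_hom zeta /\
  forall (D : cstarAlgType C) (rho : X -> D), star_hom rho ->
    exists! sigma : U -> D, star_hom sigma /\ sigma \o zeta = rho.

Definition closed_ideal (U : cstarAlgType C) (D : set U) : Prop :=
  ideal setT D /\ closed D.

Definition gen_closed_ideal (U : cstarAlgType C) (S : set U) : set U :=
  \bigcap_(D in [set D | closed_ideal D /\ S `<=` D]) D.

Definition set_sum X (I J : set X) : set X := [set x + y | x in I & y in J].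

End StarAlgebraNotions.

Section Quotient.
Variables (C : numClosedFieldType) (X : starAlgType C) (J : starIdeal X).

Local Notation I := (starIdeal_set J).

Let I0 : I 0. Proof. by case: (starIdealP J) => -[_ [? _] _] _. Qed.

Let IP a x y : I x -> I y -> I (a *: x + y).
Proof. by case: (starIdealP J) => -[_ [_ h] _] _; exact: h. Qed.

Let ID x y : I x -> I y -> I (x + y).
Proof. by move=> Ix Iy; rewrite -[x]scale1r; exact: IP. Qed.

Let IZ a x : I x -> I (a *: x).
Proof. by move=> Ix; rewrite -[_ *: _]addr0; exact: IP. Qed.

Let IN x : I x -> I (- x).
Proof. by rewrite -scaleN1r; exact: IZ. Qed.

Let IMl x y : I y -> I (x ** y).
Proof. by case: (starIdealP J) => -[_ _ h] _ Iy; exact: (h x y _ Iy).1. Qed.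

Let IMr x y : I y -> I (y ** x).
Proof. by case: (starIdealP J) => -[_ _ h] _ Iy; exact: (h x y _ Iy).2. Qed.

Let IS x : I x -> I (star x).
Proof. by case: (starIdealP J) => _; exact. Qed.

Definition ideal_rel : rel X := fun x y => `[< I (x - y) >].

Lemma ideal_rel_refl : reflexive ideal_rel.
Proof. by move=> x; apply/asboolP; rewrite subrr. Qed.

Lemma ideal_rel_sym : symmetric ideal_rel.
Proof.
by move=> x y; apply/idP/idP => /asboolP h; apply/asboolP; rewrite -opprB;
  exact: IN.
Qed.

Lemma ideal_rel_trans : transitive ideal_rel.
Proof.
move=> y x z /asboolP h1 /asboolP h2; apply/asboolP.
by rewrite -(subrKA y); exact: ID.
Qed.

Canonical ideal_equiv :=
  EquivRel ideal_rel ideal_rel_refl ideal_rel_sym ideal_rel_trans.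

Definition quot := {eq_quot ideal_equiv}.
HB.instance Definition _ : EqQuotient _ ideal_equiv quot := EqQuotient.on quot.
HB.instance Definition _ := Choice.on quot.

Definition quot_pi (x : X) : quot := \pi_quot x.

Lemma quot_piP (x y : X) : quot_pi x = quot_pi y <-> I (x - y).
Proof.
by split=> [/eqmodP /asboolP //|h]; apply/eqmodP; apply/asboolP.
Qed.

Let reprP (x : X) : I (repr (quot_pi x) - x).
Proof. by apply/quot_piP; rewrite /quot_pi reprK. Qed.

Let quotW_ind (P : quot -> Prop) : (forall x, P (quot_pi x)) -> forall q, P q.
Proof. by move=> h q; rewrite -[q]reprK; exact: h. Qed.

Let qadd (x y : quot) : quot := quot_pi (repr x + repr y).
Let qopp (x : quot) : quot := quot_pi (- repr x).
Let qscale (a : C) (x : quot) : quot := quot_pi (a *: repr x).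
Let qmul (x y : quot) : quot := quot_pi (repr x ** repr y).
Let qstar (x : quot) : quot := quot_pi (star (repr x)).

Let qaddE x y : qadd (quot_pi x) (quot_pi y) = quot_pi (x + y).
Proof. by apply/quot_piP; rewrite opprD addrACA; exact: ID. Qed.

Let qoppE x : qopp (quot_pi x) = quot_pi (- x).
Proof. by apply/quot_piP; rewrite -opprD; exact: IN. Qed.

Let qscaleE a x : qscale a (quot_pi x) = quot_pi (a *: x).
Proof. by apply/quot_piP; rewrite -scalerBr; exact: IZ. Qed.

Let amulNl (x y : X) : (- x) ** y = - (x ** y).
Proof. by rewrite -scaleN1r amulZl scaleN1r. Qed.

Let amulNr (x y : X) : x ** (- y) = - (x ** y).
Proof. by rewrite -scaleN1r amulZr scaleN1r. Qed.

Let qmulE x y : qmul (quot_pi x) (quot_pi y) = quot_pi (x ** y).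
Proof.
apply/quot_piP; set x' := repr _; set y' := repr _.
have -> : x' ** y' - x ** y = x' ** (y' - y) + (x' - x) ** y.
  by rewrite amulDr amulDl amulNr amulNl addrA subrK.
by apply: ID; [apply: IMl|apply: IMr]; exact: reprP.
Qed.

Let qstarE x : qstar (quot_pi x) = quot_pi (star x).
Proof.
apply/quot_piP; have -> : - star x = star (- x).
  by rewrite -[in RHS]scaleN1r starZ rmorphN1 scaleN1r.
by rewrite -starD; exact: IS.
Qed.

Let qE := (qaddE, qoppE, qscaleE, qmulE, qstarE).

Let qaddA : associative qadd.
Proof. by elim/quotW_ind=> x; elim/quotW_ind=> y; elim/quotW_ind=> z; rewrite !qE addrA. Qed.
Let qaddC : commutative qadd.
Proof. by elim/quotW_ind=> x; elim/quotW_ind=> y; rewrite !qE addrC. Qed.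
Let qadd0 : left_id (quot_pi 0) qadd.
Proof. by elim/quotW_ind=> ?; rewrite !qE add0r. Qed.
Let qaddN : left_inverse (quot_pi 0) qopp qadd.
Proof. by elim/quotW_ind=> ?; rewrite !qE addNr. Qed.

HB.instance Definition _ := GRing.isZmodule.Build quot qaddA qaddC qadd0 qaddN.

Let qscaleA a b x : qscale a (qscale b x) = qscale (a * b) x.
Proof. by elim/quotW_ind: x => ?; rewrite !qE scalerA. Qed.
Let qscale1 : left_id 1 qscale.
Proof. by elim/quotW_ind=> ?; rewrite !qE scale1r. Qed.
Let qscaleDr : right_distributive qscale +%R.
Proof. by move=> a; elim/quotW_ind=> x; elim/quotW_ind=> y; rewrite [LHS]qE [RHS]qE scalerDr. Qed.
Let qscaleDl x : {morph qscale^~ x : a b / a + b}.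
Proof. by move=> a b; elim/quotW_ind: x => ?; rewrite /= !qE scalerDl [RHS]qE. Qed.

HB.instance Definition _ := GRing.Zmodule_isLmodule.Build C quot
  qscaleA qscale1 qscaleDr qscaleDl.

Lemma quot_piD x y : quot_pi (x + y) = quot_pi x + quot_pi y.
Proof. by rewrite [RHS]qE. Qed.
Lemma quot_piZ a x : quot_pi (a *: x) = a *: quot_pi x.
Proof. by rewrite [RHS]qE. Qed.

Let qmulA : associative qmul.
Proof. by elim/quotW_ind=> x; elim/quotW_ind=> y; elim/quotW_ind=> z; rewrite !qE amulA. Qed.
Let qmulDl : left_distributive qmul +%R.
Proof. by elim/quotW_ind=> x; elim/quotW_ind=> y; elim/quotW_ind=> z; rewrite -quot_piD !qE amulDl quot_piD. Qed.
Let qmulDr : right_distributive qmul +%R.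
Proof. by elim/quotW_ind=> x; elim/quotW_ind=> y; elim/quotW_ind=> z; rewrite -quot_piD !qE amulDr quot_piD. Qed.
Let qmulZl (a : C) (x y : quot) : qmul (a *: x) y = a *: qmul x y.
Proof.
by elim/quotW_ind: x => x; elim/quotW_ind: y => y;
  rewrite -quot_piZ !qE amulZl quot_piZ.
Qed.
Let qmulZr (a : C) (x y : quot) : qmul x (a *: y) = a *: qmul x y.
Proof.
by elim/quotW_ind: x => x; elim/quotW_ind: y => y;
  rewrite -quot_piZ !qE amulZr quot_piZ.
Qed.
Let qstarD : {morph qstar : x y / x + y}.
Proof. by elim/quotW_ind=> x; elim/quotW_ind=> y; rewrite -quot_piD !qE starD quot_piD. Qed.
Let qstarZ (a : C) (x : quot) : qstar (a *: x) = a^* *: qstar x.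
Proof. by elim/quotW_ind: x => x; rewrite -quot_piZ !qE starZ quot_piZ. Qed.
Let qstarM x y : qstar (qmul x y) = qmul (qstar y) (qstar x).
Proof. by elim/quotW_ind: x => x; elim/quotW_ind: y => y; rewrite !qE starM. Qed.
Let qstarK : involutive qstar.
Proof. by elim/quotW_ind=> x; rewrite !qE starK. Qed.

HB.instance Definition _ := Lmodule_isStarAlgebra.Build C quot
  qmulA qmulDl qmulDr qmulZl qmulZr qstarD qstarZ qstarM qstarK.

Lemma quot_pi_hom : star_hom (quot_pi : X -> quot).
Proof.
by split=> [a x y|x y|x]; rewrite ?quot_piD ?quot_piZ //; apply/esym; exact: qE.
Qed.

End Quotient.

(* The free nonunital *-algebra on A: letters are a (inl a) and its adjoint
   (inr a), and an element is a finitely supported function on words (the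
   coefficients of a noncommutative polynomial) without constant term. *)
Section FreeAlgebra.
Variables (C : numClosedFieldType) (A : choiceType).

Definition letter : Type := (A + A)%type.
Definition word : Type := seq letter.

Definition letter_star (l : letter) : letter :=
  match l with inl a => inr a | inr a => inl a end.
Definition word_star (w : word) : word := rev (map letter_star w).

Lemma letter_starK : involutive letter_star. Proof. by case. Qed.
Lemma word_starK : involutive word_star.
Proof. by move=> w; rewrite /word_star map_rev revK mapK //; exact: letter_starK. Qed.
Lemma word_star_cat u v : word_star (u ++ v) = word_star v ++ word_star u.
Proof. by rewrite /word_star map_cat rev_cat. Qed.

Definition free_pred : {pred word -> C} :=
  fun f => `[< f [::] = 0 /\ finite_set [set w | f w != 0] >].

Lemma free_pred_closed : submod_closed free_pred.
Proof.
split; first by apply/asboolP; split=> //; rewrite (_ : mkset _ = set0)//;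
  apply/seteqP; split=> w //=; rewrite eqxx.
move=> a f g /asboolP[f0 ff] /asboolP[g0 fg]; apply/asboolP; split.
  by rewrite /= [LHS](_ : _ = a * f [::] + g [::])// f0 g0 mulr0 addr0.
apply: (@sub_finite_set _ _ ([set w | f w != 0] `|` [set w | g w != 0])).
  move=> w /=; rewrite [X in X != 0](_ : _ = a * f w + g w)// => h.
  have [fw|] := eqVneq (f w) 0; last by left.
  by right; move: h; rewrite fw mulr0 add0r.
by rewrite finite_setU.
Qed.

HB.instance Definition _ :=
  GRing.isSubmodClosed.Build C (word -> C^o) free_pred free_pred_closed.

Record freeAlg := FreeAlg {
  free_coef : word -> C^o;
  freeAlgP : free_coef \in free_pred
}.

HB.instance Definition _ := [isSub for free_coef].
HB.instance Definition _ := [Choice of freeAlg by <:].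
HB.instance Definition _ := [SubChoice_isSubLmodule of freeAlg by <:].

Implicit Types (f g h : freeAlg) (u v w : word).

Lemma free_coef_nil f : free_coef f [::] = 0.
Proof. by have /asboolP[] := freeAlgP f. Qed.

Lemma free_coef_fin f : finite_set [set w | free_coef f w != 0].
Proof. by have /asboolP[] := freeAlgP f. Qed.

Lemma free_coefP f g : free_coef f =1 free_coef g -> f = g.
Proof. by move=> fg; apply/val_inj/funext. Qed.

Lemma free_coefD f g w : free_coef (f + g) w = free_coef f w + free_coef g w.
Proof. by []. Qed.

Lemma free_coefZ a f w : free_coef (a *: f) w = a * free_coef f w.
Proof. by []. Qed.

(* i runs over the factorizations w = take i w ++ drop i w *)
Definition conv (f g : word -> C^o) : word -> C^o :=
  fun w => \sum_(i < (size w).+1) f (take i w) * g (drop i w).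

Lemma free_mul_subproof f g : conv (free_coef f) (free_coef g) \in free_pred.
Proof.
apply/asboolP; split.
  by rewrite /conv big_ord1 /= free_coef_nil mul0r.
apply: (@sub_finite_set _ _ [set u ++ v | u in [set w | free_coef f w != 0]
                             & v in [set w | free_coef g w != 0]]).
  move=> w /= hw.
  have [i hi] : exists i : 'I_(size w).+1,
      free_coef f (take i w) * free_coef g (drop i w) != 0.
    apply: contrapT => h; move/eqP: hw; apply; rewrite /conv big1// => i _.
    by apply: contrapT => /eqP hi; apply: h; exists i.
  move: hi; rewrite mulf_eq0 negb_or => /andP[h1 h2].
  exists (take i w) => //; exists (drop i w) => //; exact: cat_take_drop.
by apply: finite_image2; exact: free_coef_fin.
Qed.

Lemma free_star_subproof f :
  (fun w => (free_coef f (word_star w))^* : C^o) \in free_pred.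
Proof.
apply/asboolP; split; first by rewrite /= free_coef_nil conjC0.
apply: (@sub_finite_set _ _ (word_star @` [set w | free_coef f w != 0])).
  move=> w /=; rewrite conjC_eq0 => h; exists (word_star w) => //.
  exact: word_starK.
exact/finite_image/free_coef_fin.
Qed.

Definition free_mul f g : freeAlg := FreeAlg (free_mul_subproof f g).
Definition free_star f : freeAlg := FreeAlg (free_star_subproof f).

Let convA (f g h : word -> C^o) : conv f (conv g h) = conv (conv f g) h.
Proof.
apply/funext => w; rewrite /conv.
transitivity (\sum_(k < (size w).+1) \sum_(i < (size w).+1 | (i <= k)%N)
    f (take i w) * g (take (k - i) (drop i w)) * h (drop k w)).
  rewrite (exchange_big_dep xpredT) //=; apply: eq_bigr => i _.
  have le_i : (i <= size w)%N by rewrite -ltnS.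
  rewrite big_distrr /= size_drop -subSn //.
  rewrite -(big_mkord xpredT (fun j => f (take i w) *
    (g (take j (drop i w)) * h (drop j (drop i w))))).
  rewrite -(big_mkord (fun k => (i <= k)%N) (fun k => f (take i w) *
    g (take (k - i) (drop i w)) * h (drop k w))).
  rewrite -(big_nat_widenl i 0 _ xpredT) //; apply: esym.
  rewrite -[X in index_iota X _]add0n big_addn.
  by apply: eq_bigr => j _; rewrite addnK drop_drop mulrA.
apply: eq_bigr => k _.
have le_k : (k <= size w)%N by rewrite -ltnS.
rewrite big_distrl /= size_takel //.
rewrite (big_ord_widen (size w).+1 (fun i => f (take i (take k w)) *
  g (drop i (take k w)) * h (drop k w))) //.
apply: eq_bigr => i le_ik.
by rewrite take_takel // take_drop subnK.
Qed.

Let free_mulA : associative free_mul.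
Proof. by move=> f g h; apply/val_inj; exact: convA. Qed.

Let free_mulDl : left_distributive free_mul +%R.
Proof.
move=> f g h; apply: free_coefP => w; rewrite free_coefD /= /conv -big_split.
by apply: eq_bigr => i _; exact: mulrDl.
Qed.

Let free_mulDr : right_distributive free_mul +%R.
Proof.
move=> f g h; apply: free_coefP => w; rewrite free_coefD /= /conv -big_split.
by apply: eq_bigr => i _; exact: mulrDr.
Qed.

Let free_mulZl (a : C) f g : free_mul (a *: f) g = a *: free_mul f g.
Proof.
apply: free_coefP => w; rewrite free_coefZ /= /conv big_distrr.
by apply: eq_bigr => i _; exact: esym (mulrA _ _ _).
Qed.

Let free_mulZr (a : C) f g : free_mul f (a *: g) = a *: free_mul f g.
Proof.
apply: free_coefP => w; rewrite free_coefZ /= /conv big_distrr.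
by apply: eq_bigr => i _; exact: mulrCA.
Qed.

Let free_starD : {morph free_star : f g / f + g}.
Proof.
by move=> f g; apply: free_coefP => w; rewrite free_coefD /= -rmorphD.
Qed.

Let free_starZ (a : C) f : free_star (a *: f) = a^* *: free_star f.
Proof. by apply: free_coefP => w; rewrite free_coefZ /= -rmorphM. Qed.

Let free_starM f g : free_star (free_mul f g) = free_mul (free_star g) (free_star f).
Proof.
apply: free_coefP => w; rewrite /= /conv rmorph_sum /=.
rewrite /word_star size_rev size_map (reindex_inj rev_ord_inj) /=.
apply: eq_bigr => i _; rewrite rmorphM mulrC subSS.
have le_i : (i <= size w)%N by rewrite -ltnS.
by rewrite drop_rev take_rev size_map subKn // map_take map_drop.
Qed.

Let free_starK : involutive free_star.
Proof.
by move=> f; apply: free_coefP => w; rewrite /= conjCK word_starK.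
Qed.

HB.instance Definition _ := Lmodule_isStarAlgebra.Build C freeAlg
  free_mulA free_mulDl free_mulDr free_mulZl free_mulZr
  free_starD free_starZ free_starM free_starK.

Lemma free_gen_subproof (a : A) :
  (fun w => `[< w = [:: inl a] >]%:R : C^o) \in free_pred.
Proof.
apply/asboolP; split; first by rewrite /= asboolF.
apply: (@sub_finite_set _ _ [set [:: inl a]]) => // w /=.
by case: asboolP => //; rewrite eqxx.
Qed.

Definition free_gen (a : A) : freeAlg := FreeAlg (free_gen_subproof a).

End FreeAlgebra.

(* Closed subgroups of the torus T^A.  As T^A is closed in C^A, being closed
   in T^A is the same as being closed in C^A for the product topology. *)
Record torusSubgroup (C : numClosedFieldType) (A : choiceType) := TorusSubgroup {
  torus_set :> set {ptws A -> C};
  torus_norm : forall l, torus_set l -> forall a, `|l a| = 1;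
  torus1 : torus_set (fun=> 1);
  torusM : forall l m, torus_set l -> torus_set m ->
    torus_set (fun a => l a * m a);
  torusV : forall l, torus_set l -> torus_set (fun a => (l a)^-1);
  torus_closed : closed torus_set
}.

Section CharacterGroup.
Variables (C : numClosedFieldType) (A : choiceType) (H : torusSubgroup C A).

Definition torus_mul (l m : set_type H) : set_type H :=
  SigSub (mem_set (torusM (set_valP l) (set_valP m))).

Record character := Character {
  char_fun :> set_type H -> C;
  char_cont : continuous char_fun;
  char_norm : forall l, `|char_fun l| = 1;
  char_mul : forall l m, char_fun (torus_mul l m) = char_fun l * char_fun m
}.

Lemma characterP (chi psi : character) : chi =1 psi -> chi = psi.
Proof.
case: chi psi => [f f1 f2 f3] [g g1 g2 g3] /= /funext fg; subst g.
by congr Character; exact: Prop_irrelevance.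
Qed.

#[local] Obligation Tactic := idtac.

Let char_neq0 (chi : character) l : chi l != 0.
Proof. by rewrite -normr_gt0 char_norm. Qed.

Program Definition char0 := @Character (fun=> 1) _ _ _.
Next Obligation. exact: cst_continuous. Qed.
Next Obligation. by move=> l; exact: normr1. Qed.
Next Obligation. by move=> l m; rewrite mulr1. Qed.

Program Definition char_add (chi psi : character) :=
  @Character (fun l => chi l * psi l) _ _ _.
Next Obligation. 
move=> chi psi l; have := @cvgM C _ (nbhs l) _ chi psi _ _ (@char_cont chi l)
  (@char_cont psi l); exact.
 Qed.
Next Obligation. by move=> chi psi l /=; rewrite normrM !char_norm mulr1. Qed.
Next Obligation. by move=> chi psi l m /=; rewrite !char_mul mulrACA. Qed.

Program Definition char_opp (chi : character) :=
  @Character (fun l => (chi l)^-1) _ _ _.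
Next Obligation. 
move=> chi l; have := @cvgV C _ (nbhs l) _ chi _ (char_neq0 chi l)
  (@char_cont chi l); exact.
 Qed.
Next Obligation. by move=> chi l /=; rewrite normfV char_norm invr1. Qed.
Next Obligation. by move=> chi l m /=; rewrite char_mul invfM. Qed.

HB.instance Definition _ := gen_eqMixin character.
HB.instance Definition _ := gen_choiceMixin character.

Let char_addA : associative char_add.
Proof. by move=> x y z; apply: characterP => l; exact: mulrA. Qed.
Let char_addC : commutative char_add.
Proof. by move=> x y; apply: characterP => l; exact: mulrC. Qed.
Let char_add0 : left_id char0 char_add.
Proof. by move=> x; apply: characterP => l; exact: mul1r. Qed.
Let char_addN : left_inverse char0 char_opp char_add.
Proof. by move=> x; apply: characterP => l; exact: mulVf. Qed.

HB.instance Definition _ := GRing.isZmodule.Build character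
  char_addA char_addC char_add0 char_addN.

Program Definition char_coord (a : A) :=
  @Character (fun l => (set_val l : A -> C) a) _ _ _.
Next Obligation.
move=> a l.
apply: (@cvg_comp _ _ _ set_val (fun x : {ptws A -> C} => x a) _
  (nbhs (set_val l : {ptws A -> C}))).
  exact: initial_continuous.
have := @proj_continuous A (fun=> C) a (set_val l); exact.
Qed.
Next Obligation. by move=> a l; exact: (torus_norm (set_valP l)). Qed.
Next Obligation. by []. Qed.

End CharacterGroup.

Section CuntzKriegerType.
Variables (C : numClosedFieldType) (A : choiceType).
Variables (I : starIdeal (freeAlg C A)) (H : torusSubgroup C A).

Local Notation X := (quot I).

Definition gen (a : A) : X := quot_pi I (free_gen C a).

Definition letter_val (l : letter A) : X :=
  match l with inl a => gen a | inr a => star (gen a) end.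

Definition word_val (l : letter A) (s : word A) : X :=
  foldl (fun x k => x ** letter_val k) (letter_val l) s.

Definition words : set X := [set x | exists l s, x = word_val l s].

Definition gauge_action (t : set_type H -> X -> X) : Prop :=
  [/\ forall l, star_aut (t l),
      forall l m, t (torus_mul l m) = t l \o t m
    & forall l a, t l (gen a) = (set_val l : A -> C) a *: gen a].

Definition property_A : Prop := exists t, gauge_action t.

Definition letter_bal (l : letter A) : character H :=
  match l with inl a => char_coord H a | inr a => - char_coord H a end.

Definition word_bal (w : word A) : character H := \sum_(l <- w) letter_bal l.

(* bal x is computed from some spelling of x as a word.  For a nonzero word x
   it does not depend on the spelling when property_A holds (bal_word_val). *)
Definition bal (x : X) : character H :=
  word_bal (xget [::] [set w | exists l s, w = l :: s /\ word_val l s = x]).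

Definition words_bal (n : character H) : set X :=
  [set x | [/\ words x, x != 0 & bal x = n]].

Definition core : set X := lspan (words_bal 0).

Definition property_B : Prop := locally_matricial core.

Definition property_C' : Prop :=
  forall x, words x -> ~ words_bal 0 x ->
  forall e, core e -> projection e -> e != 0 ->
  exists p, [/\ core p, projection p, p != 0, proj_le p e & p ** x ** p = 0].

Definition CK_system : Prop :=
  [/\ property_A, property_B, property_C'
    & exists (D : cstarAlgType C) (rho : X -> D),
        star_hom rho /\ set_inj core rho].

Lemma letter_bal_star l : letter_bal (letter_star l) = - letter_bal l.
Proof. by case: l => a //=; rewrite opprK. Qed.

Lemma letter_val_star l : letter_val (letter_star l) = star (letter_val l).
Proof. by case: l => a //=; rewrite starK. Qed.

Lemma word_val_rcons l s k : word_val l (rcons s k) = word_val l s ** letter_val k.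
Proof. by rewrite /word_val foldl_rcons. Qed.

Lemma word_val_cat l s k r :
  word_val l (s ++ k :: r) = word_val l s ** word_val k r.
Proof.
elim/last_ind: r => [|r j IHr]; first by rewrite cats1 word_val_rcons.
by rewrite -rcons_cons -rcons_cat !word_val_rcons IHr amulA.
Qed.

Lemma wordsM x y : words x -> words y -> words (x ** y).
Proof.
move=> [l [s ->]] [k [r ->]]; exists l, (s ++ k :: r).
by rewrite word_val_cat.
Qed.

Lemma words_star x : words x -> words (star x).
Proof.
move=> [l [s ->]]; elim/last_ind: s => [|s k IHs].
  by exists (letter_star l), [::]; rewrite [RHS]letter_val_star.
rewrite word_val_rcons starM; apply: wordsM => //.
by exists (letter_star k), [::]; rewrite [RHS]letter_val_star.
Qed.

Lemma gauge_word_val t l s m : gauge_action t ->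
  t m (word_val l s) = word_bal (l :: s) m *: word_val l s.
Proof.
move=> [taut _ tgen]; have [[_ tM tS] _] := taut m.
have tZ a x : t m (a *: x) = a *: t m x.
  have [[tL _ _] _] := taut m.
  have t0 : t m 0 = 0.
    have := tL 1 0 0; rewrite !scale1r !addr0 => /(congr1 (fun z => z - t m 0)).
    by rewrite addrK subrr.
  by have := tL a x 0; rewrite !addr0 t0 addr0.
have tl k : t m (letter_val k) = letter_bal k m *: letter_val k.
  case: k => a /=; rewrite ?tS tgen // starZ; congr (_ *: _).
  by rewrite -[RHS]/((char_coord H a m)^-1) invC_norm char_norm expr1n invr1 mul1r.
elim/last_ind: s => [|s k IHs]; first by rewrite /word_bal big_seq1 tl.
rewrite word_val_rcons tM IHs tl amulZl amulZr scalerA.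
by rewrite /word_bal -rcons_cons -cats1 big_cat big_seq1.
Qed.


Lemma bal_word_val l s : property_A -> word_val l s != 0 ->
  bal (word_val l s) = word_bal (l :: s).
Proof.
move=> [t tP] x0; apply: characterP => m; rewrite /bal.
case: xgetP => [w _ [k [r [-> eqx]]]|/(_ (l :: s))]; last first.
  by case; exists l, s.
have := gauge_word_val k r m tP; rewrite eqx (gauge_word_val l s m tP).
move/eqP; rewrite -subr_eq0 -scalerBl scaler_eq0 (negbTE x0) orbF subr_eq0.
by move/eqP.
Qed.

Lemma gauge_bal t m x : gauge_action t -> words x -> x != 0 ->
  t m x = bal x m *: x.
Proof.
move=> tP [l [s ->]] x0; rewrite (gauge_word_val l s m tP) bal_word_val //.
by exists t.
Qed.

Lemma bal_gen a : property_A -> gen a != 0 -> bal (gen a) = char_coord H a.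
Proof.
move=> pA x0; have := @bal_word_val (inl a) [::] pA x0.
by rewrite /word_bal big_seq1.
Qed.

Lemma balM x y : property_A -> words x -> words y -> x ** y != 0 ->
  bal (x ** y) = bal x + bal y.
Proof.
move=> pA [l [s ->]] [k [r ->]] xy0.
have x0 : word_val l s != 0.
  apply: contraNneq xy0 => ->.
  by rewrite -(scale0r (word_val k r)) amulZl !scale0r.
have y0 : word_val k r != 0.
  apply: contraNneq xy0 => ->.
  by rewrite -(scale0r (word_val k r)) amulZr !scale0r.
rewrite -word_val_cat in xy0 *; rewrite !bal_word_val //.
by rewrite /word_bal -cat_cons big_cat.
Qed.

Lemma bal_star x : property_A -> words x -> x != 0 -> bal (star x) = - bal x.
Proof.
move=> pA wx x0; have sx0 : star x != 0.
  apply: contraNneq x0 => sx; rewrite -[x]starK sx.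
  by have := starZ 0 (0 : X); rewrite conjC0 !scale0r => ->.
have [t tP] := pA; apply: characterP => m.
have := gauge_bal m tP (words_star wx) sx0.
have -> : t m (star x) = star (t m x).
  by have [taut _ _] := tP; have [[_ _ ->] _] := taut m.
rewrite (gauge_bal m tP wx x0) starZ.
move/eqP; rewrite -subr_eq0 -scalerBl scaler_eq0 (negbTE sx0) orbF subr_eq0.
move=> /eqP <-; rewrite -[RHS]/((bal x m)^-1).
by rewrite [RHS]invC_norm char_norm expr1n invr1 mul1r.
Qed.

End CuntzKriegerType.

Arguments core {C A} I H _.

Section Ideals.
Variables (C : numClosedFieldType) (X : starAlgType C).

Definition Sigma : set (set X) := [set J | star_ideal setT J].

Definition Sigma_sub (B : set X) : set (set X) := [set J `&` B | J in Sigma].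

(* X is identified with its image under zeta *)
Definition Phi (U : cstarAlgType C) (zeta : X -> U) (J : set X) : set U :=
  gen_closed_ideal (zeta @` J).

End Ideals.

(* Main.v *)
(** An ideal [I] of [B] in the image of restriction generates in [F/I] the ideal [L] spanned by
    the products [x j y] with [x, y] words and [j] in [I], and [I(I)] is the closure of [L],
    because the range of [zeta] is dense.  Everything reduces to [closure L] meeting the core in
    [L].  Finite dimensional calculus in the core replaces an element of the core by its support
    projection [e].  If [l] in [L] is at distance less than 1 from [e], write [l = k + w] with
    [k] in the core and in [L], and [w] a combination of words of nonzero balance.  By property
    (C'), [1] is not an eigenvalue of [e - k], since a projection below the eigenprojection
    would compress [w] to [0] and contradict [|e - l| < 1].  As [e - k] is [e] modulo [L] and is
    algebraic, [e] lies in [L].  Sums of closed ideals [closure L] are closed because [L] has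
    local units that are projections of the core. *)

Require Import Defs.
From HB Require Import structures.
From mathcomp Require Import all_boot all_order all_algebra.
From mathcomp Require Import boolp classical_sets functions cardinality.
From mathcomp Require Import reals topology normedtype complex.
From mathcomp Require Import ring.

Set Implicit Arguments.
Unset Strict Implicit.
Unset Printing Implicit Defensive.

Import Order.TTheory GRing.Theory Num.Theory.
Import numFieldNormedType.Exports.

Local Open Scope classical_set_scope.
Local Open Scope ring_scope.

Local Notation subspace := Defs.subspace.

(** * Computation rules in star algebras, subspaces, spans and ideals *)

Section StarAlgebraTheory.
Variables (C : numClosedFieldType) (X : starAlgType C).
Implicit Types (x y z p e : X) (a : C) (S P : set X).

Lemma amul0l x : 0 ** x = 0.
Proof. by rewrite -(scale0r (0 : X)) amulZl !scale0r. Qed.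

Lemma amul0r x : x ** 0 = 0.
Proof. by rewrite -(scale0r (0 : X)) amulZr !scale0r. Qed.

Lemma amulNl x y : (- x) ** y = - (x ** y).
Proof. by rewrite -scaleN1r amulZl scaleN1r. Qed.

Lemma amulNr x y : x ** (- y) = - (x ** y).
Proof. by rewrite -scaleN1r amulZr scaleN1r. Qed.

Lemma amulBl x y z : (x - y) ** z = x ** z - y ** z.
Proof. by rewrite amulDl amulNl. Qed.

Lemma amulBr x y z : x ** (y - z) = x ** y - x ** z.
Proof. by rewrite amulDr amulNr. Qed.

Lemma amul_suml n (f : 'I_n -> X) x : (\sum_i f i) ** x = \sum_i f i ** x.
Proof.
by apply: (big_morph (fun u => u ** x)) => [u v|]; rewrite ?amulDl ?amul0l.
Qed.

Lemma amul_sumr n (f : 'I_n -> X) x : x ** (\sum_i f i) = \sum_i x ** f i.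
Proof.
by apply: (big_morph (fun u => x ** u)) => [u v|]; rewrite ?amulDr ?amul0r.
Qed.

Lemma star0 : star (0 : X) = 0.
Proof. by rewrite -(scale0r (0 : X)) starZ conjC0 !scale0r. Qed.

Lemma starN x : star (- x) = - star x.
Proof. by rewrite -scaleN1r starZ rmorphN1 scaleN1r. Qed.

Lemma starB x y : star (x - y) = star x - star y.
Proof. by rewrite starD starN. Qed.

Lemma star_sum n (f : 'I_n -> X) : star (\sum_i f i) = \sum_i star (f i).
Proof. by apply: (big_morph star); [exact: starD|exact: star0]. Qed.

Lemma subspaceD S x y : subspace S -> S x -> S y -> S (x + y).
Proof. by move=> [_ h] Sx Sy; rewrite -[x]scale1r; exact: h. Qed.

Lemma subspaceZ S a x : subspace S -> S x -> S (a *: x).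
Proof. by move=> [h0 h] Sx; rewrite -[_ *: _]addr0; exact: h. Qed.

Lemma subspaceN S x : subspace S -> S x -> S (- x).
Proof. by move=> hS; rewrite -scaleN1r; exact: subspaceZ. Qed.

Lemma subspaceB S x y : subspace S -> S x -> S y -> S (x - y).
Proof. by move=> hS Sx Sy; apply: subspaceD => //; exact: subspaceN. Qed.

Lemma subspace_sum S n (f : 'I_n -> X) :
  subspace S -> (forall i, S (f i)) -> S (\sum_i f i).
Proof.
move=> hS h; elim/big_ind: _ => // [|x y]; first by case: hS.
exact: subspaceD.
Qed.

Lemma lspan_subspace S : subspace (lspan S).
Proof.
split; first by exists 0%N, (fun=> 0), (fun=> 0); split; [case|rewrite big_ord0].
move=> a x y [n [c [w [Sw ->]]]] [m [d [v [Sv ->]]]].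
exists (n + m)%N, (fun i => match fintype.split i with inl j => a * c j | inr j => d j end),
  (fun i => match fintype.split i with inl j => w j | inr j => v j end).
split; first by move=> i; case: (fintype.split i).
rewrite big_split_ord /= scaler_sumr; congr (_ + _); apply: eq_bigr => i _.
  by rewrite (unsplitK (inl i)) scalerA.
by rewrite (unsplitK (inr i)).
Qed.

Lemma sub_lspan S : S `<=` lspan S.
Proof.
move=> x Sx; exists 1%N, (fun=> 1), (fun=> x); split=> //.
by rewrite big_ord1 scale1r.
Qed.

Lemma lspan_sub S P : subspace P -> S `<=` P -> lspan S `<=` P.
Proof.
move=> hP SP _ [n [c [w [Sw ->]]]]; apply: subspace_sum => // i.
by apply: subspaceZ => //; exact: SP.
Qed.

Lemma lspan_bilin S T (P : set X) : subspace P ->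
  (forall x y, S x -> T y -> P (x ** y)) ->
  forall x y, lspan S x -> lspan T y -> P (x ** y).
Proof.
move=> hP h x y Sx Ty.
suff: lspan S `<=` [set x | P (x ** y)] by exact.
apply: lspan_sub => [|{Sx}x Sx /=].
  split=> [|a u v /= Pu Pv]; first by rewrite /= amul0l; case: hP.
  by rewrite amulDl amulZl; case: hP => _; exact.
suff: lspan T `<=` [set y | P (x ** y)] by exact.
apply: lspan_sub => [|{Ty}y Ty /=]; last exact: h.
split=> [|a u v /= Pu Pv]; first by rewrite /= amul0r; case: hP.
by rewrite amulDr amulZr; case: hP => _; exact.
Qed.

Lemma ideal_amull J x y : @ideal C X setT J -> J y -> J (x ** y).
Proof. by move=> [_ _ h] Jy; exact: (h x y _ Jy).1. Qed.

Lemma ideal_amulr J x y : @ideal C X setT J -> J y -> J (y ** x).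
Proof. by move=> [_ _ h] Jy; exact: (h x y _ Jy).2. Qed.

Lemma projection_leE p e : projection p -> projection e -> proj_le p e ->
  e ** p = p.
Proof. by move=> [sp _] [se _] pe; rewrite -[RHS]sp -[in RHS]pe starM se sp. Qed.

End StarAlgebraTheory.

(** * Star homomorphisms *)

Section StarHom.
Variables (C : numClosedFieldType) (X Y : starAlgType C) (f : X -> Y).
Hypothesis hf : star_hom f.

Lemma shomD x y : f (x + y) = f x + f y.
Proof. by case: hf => l _ _; have := l 1 x y; rewrite !scale1r. Qed.

Lemma shom0 : f 0 = 0.
Proof. by apply: (@addrI _ (f 0)); rewrite -shomD !addr0. Qed.

Lemma shomZ a x : f (a *: x) = a *: f x.
Proof. by case: hf => l _ _; have := l a x 0; rewrite shom0 !addr0. Qed.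

Lemma shomN x : f (- x) = - f x.
Proof. by rewrite -scaleN1r shomZ scaleN1r. Qed.

Lemma shomB x y : f (x - y) = f x - f y.
Proof. by rewrite shomD shomN. Qed.

Lemma shomM x y : f (x ** y) = f x ** f y.
Proof. by case: hf. Qed.

Lemma shom_star x : f (star x) = star (f x).
Proof. by case: hf. Qed.

Lemma shom_sum n (u : 'I_n -> X) : f (\sum_i u i) = \sum_i f (u i).
Proof. by apply: (big_morph f); [exact: shomD|exact: shom0]. Qed.

Lemma shom_preimage_ideal D : ideal setT D -> ideal setT (f @^-1` D).
Proof.
move=> hD; have [_ [D0 sD] _] := hD; split=> // [|b x _ Dx].
  split=> [|a x y Dx Dy]; first by rewrite /= shom0.
  by rewrite /= shomD shomZ; exact: sD.
by split; rewrite /= shomM; [exact: ideal_amull|exact: ideal_amulr].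
Qed.

End StarHom.

(** * Norm estimates and closures in a C*-algebra *)

Section CStarNorm.
Variables (C : numClosedFieldType) (U : cstarAlgType C).
Implicit Types (x y z p : U) (S P : set U).

Lemma star_amul_eq0 x : star x ** x = 0 -> x = 0.
Proof.
move=> h; apply/eqP; rewrite -normr_eq0 -sqrf_eq0.
by rewrite -cstar_normS h normr0.
Qed.

(** The C*-identity and submultiplicativity bound [|y| ^+ 2] by [|star y| * |y|]; dividing by [|y|]
    and using the result for both [x] and [star x] gives equality. *)
Lemma norm_star x : `|star x| = `|x|.
Proof.
have le y : `|y| <= `|star y|.
  have [->|y0] := eqVneq y 0; first by rewrite normr0.
  have y0' : 0 < `|y| by rewrite normr_gt0.
  by rewrite -(ler_pM2r y0') -expr2 -cstar_normS cstar_normM.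
by apply/eqP; rewrite eq_le le andbT -{2}[x]starK le.
Qed.

Lemma norm_projection p : projection p -> p != 0 -> `|p| = 1.
Proof.
move=> [sp pp] p0; have := cstar_normS p; rewrite sp pp => h.
have p0' : `|p| != 0 by rewrite normr_eq0.
by apply: (mulfI p0'); rewrite mulr1 -expr2.
Qed.

Lemma norm_projection_le1 p : projection p -> `|p| <= 1.
Proof.
move=> hp; have [->|/norm_projection ->//] := eqVneq p 0.
by rewrite normr0 ler01.
Qed.

Lemma closureP S x :
  closure S x <-> forall e : C, 0 < e -> exists2 s, S s & `|x - s| < e.
Proof.
split=> [h e e0|h B /nbhs_ballP[e e0 eB]].
  have [s [Ss xs]] := h _ (nbhsx_ballx x e e0).
  by exists s => //; move: xs; rewrite -ball_normE.
have [s Ss xs] := h e e0; exists s; split=> //; apply: eB.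
by rewrite -ball_normE.
Qed.

Lemma closure_lift S x (f : U -> U) (P : set U) (M : C) : 0 <= M ->
  (forall s, S s -> P (f s)) -> (forall s, `|f x - f s| <= M * `|x - s|) ->
  closure S x -> closure P (f x).
Proof.
(* The tolerance is divided by [M + 1] because [M] may be [0]. *)
move=> M0 SP fM /closureP h; apply/closureP => e e0.
have M1 : 0 < M + 1 by rewrite ltr_wpDl.
have [s Ss xs] := h (e / (M + 1)) (divr_gt0 e0 M1).
exists (f s); first exact: SP.
apply: le_lt_trans (fM s) _; rewrite ltr_pdivlMr // mulrC in xs.
by apply: le_lt_trans xs; rewrite ler_wpM2r // lerDl ler01.
Qed.

Lemma closure_idem S : closure (closure S) `<=` closure S.
Proof. by have /closure_id <- := @closed_closure _ S. Qed.

Lemma closure_subspace S : subspace S -> subspace (closure S).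
Proof.
move=> hS; have S0 := hS.1; split; first exact: subset_closure.
have step1 a x s : closure S x -> S s -> closure S (a *: x + s).
  move=> Sx Ss; apply: (@closure_lift S x (fun x => a *: x + s) S `|a|) => //.
    by move=> t St; case: hS => _; exact.
  by move=> t; rewrite opprD addrACA subrr addr0 -scalerBr normrZ.
move=> a x y Sx Sy; apply: closure_idem.
apply: (@closure_lift S y (fun y => a *: x + y) _ 1) => //; first by move=> s; exact: step1.
by move=> s; rewrite opprD addrACA subrr add0r mul1r.
Qed.

(** One factor is approximated at a time: with the other one fixed, multiplication is Lipschitz, and
    idempotence of the closure combines the two passages. *)
Lemma closure_amul S T P : (forall x y, S x -> T y -> P (x ** y)) ->
  forall x y, closure S x -> closure T y -> closure P (x ** y).
Proof.
move=> h x y Sx Ty; apply: closure_idem.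
apply: (@closure_lift S x (fun x => x ** y) _ `|y|) => // [s Ss|s]; last first.
  by rewrite -amulBl mulrC cstar_normM.
apply: (@closure_lift T y (fun y => s ** y) _ `|s|) => // [t Tt|t]; last first.
  by rewrite -amulBr cstar_normM.
exact: h.
Qed.

Lemma closure_star S P : (forall x, S x -> P (star x)) ->
  forall x, closure S x -> closure P (star x).
Proof.
move=> h x; apply: (@closure_lift S x star P 1) => // s.
by rewrite -starB norm_star mul1r.
Qed.

Lemma closure_star_subalgebra S : star_subalgebra S -> star_subalgebra (closure S).
Proof.
by move=> [h1 h2 h3]; split; [exact: closure_subspace|exact: closure_amul|
  exact: closure_star].
Qed.

End CStarNorm.

(** * Closed star subalgebras as C*-algebras, and density of the universal representation *)

Record closedStarSubalg (C : numClosedFieldType) (U : cstarAlgType C) :=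
  ClosedStarSubalg {
    css_set :> set U;
    css_subalg : star_subalgebra css_set;
    css_closed : closed css_set
  }.

Section ClosedStarSubalgType.
Variables (C : numClosedFieldType) (U : cstarAlgType C) (S : closedStarSubalg U).

Definition css_pred : {pred U} := fun x => `[< css_set S x >].

Lemma css_predP x : reflect (css_set S x) (x \in css_pred).
Proof. exact: asboolP. Qed.

Lemma css_submod_closed : submod_closed css_pred.
Proof.
have [[S0 hS] _ _] := css_subalg S; split; first exact/css_predP.
by move=> a x y /css_predP Sx /css_predP Sy; apply/css_predP; exact: hS.
Qed.

HB.instance Definition _ :=
  GRing.isSubmodClosed.Build C U css_pred css_submod_closed.

(** The universal property quantifies over C*-algebras given as types, so a closed star subalgebra
    is turned into a type carrying the restricted norm and operations. *)
Record css := Css { css_val : U; cssP : css_val \in css_pred }.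

HB.instance Definition _ := [isSub for css_val].
HB.instance Definition _ := [Choice of css by <:].
HB.instance Definition _ := [SubChoice_isSubLmodule of css by <:].

Let css_inj : injective css_val. Proof. exact: val_inj. Qed.

Let mem_css (x : css) : css_set S (css_val x). Proof. exact/css_predP/cssP. Qed.

Let css_norm_triangle (x y : css) :
  `|css_val (x + y)| <= `|css_val x| + `|css_val y|.
Proof. exact: ler_normD. Qed.

Let css_normZ (a : C) (x : css) : `|css_val (a *: x)| = `|a| * `|css_val x|.
Proof. exact: normrZ. Qed.

Let css_norm0_eq0 (x : css) : `|css_val x| = 0 -> x = 0.
Proof. by move/normr0_eq0 => h; exact: css_inj. Qed.

HB.instance Definition _ := Lmodule_isNormed.Build C css
  css_norm_triangle css_normZ css_norm0_eq0.

Let css_ball (x y : css) (e : C) :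
  ball x e y -> ball (css_val x) e (css_val y).
Proof. by rewrite -!ball_normE. Qed.

Let ball_css (x y : css) (e : C) :
  ball (css_val x) e (css_val y) -> ball x e y.
Proof. by rewrite -!ball_normE. Qed.

Let css_complete (F : set_system css) : ProperFilter F -> cauchy F -> cvg F.
Proof.
move=> FF Fc; pose G := css_val @ F.
have GF : ProperFilter G by exact: fmap_proper_filter.
have Gc : cauchy G.
  apply/cauchyP => e e0.
  move/cauchyP : Fc => /(_ e e0)[x Fx]; exists (css_val x).
  change (F [set y | ball (css_val x) e (css_val y)]).
  by apply: filterS Fx => y /css_ball.
(* The limit exists in the complete space [U], and closedness of [S] brings it back into the
   subalgebra. *)
have Gl : cvg G := @cauchy_cvg _ G GF Gc; set l := lim G in Gl.
have Sl : css_set S l.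
  apply: (css_closed (c := S)) => B Bl; have FB : F (css_val @^-1` B) := Gl _ Bl.
  have [x Bx] := filter_ex FB.
  exists (css_val x); split; last exact: Bx.
  exact: mem_css.
have Sl' : l \in css_pred by exact/css_predP.
apply: (@cvgP _ _ (Css Sl')).
apply/cvg_ballP => e e0.
move/cvg_ballP : Gl => /(_ e e0).
change (F [set y | ball l e (css_val y)] -> F [set y | ball (Css Sl') e y]).
by apply: filterS => x; exact: (ball_css (x := Css Sl')).
Qed.

HB.instance Definition _ := Uniform_isComplete.Build css css_complete.

Lemma css_mul_subproof (x y : css) : css_val x ** css_val y \in css_pred.
Proof. by apply/css_predP; have [_ + _] := css_subalg S; exact. Qed.

Lemma css_star_subproof (x : css) : star (css_val x) \in css_pred.
Proof. by apply/css_predP; have [_ _] := css_subalg S; exact. Qed.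

Let cmul x y := Css (css_mul_subproof x y).
Let cstar x := Css (css_star_subproof x).

Let cmulA : associative cmul.
Proof. by move=> *; apply/css_inj/amulA. Qed.
Let cmulDl : left_distributive cmul +%R.
Proof. by move=> *; apply/css_inj/amulDl. Qed.
Let cmulDr : right_distributive cmul +%R.
Proof. by move=> *; apply/css_inj/amulDr. Qed.
Let cmulZl (a : C) (x y : css) : cmul (a *: x) y = a *: cmul x y.
Proof. exact/css_inj/amulZl. Qed.
Let cmulZr (a : C) (x y : css) : cmul x (a *: y) = a *: cmul x y.
Proof. exact/css_inj/amulZr. Qed.
Let cstarD : {morph cstar : x y / x + y}.
Proof. by move=> *; apply/css_inj/starD. Qed.
Let cstarZ (a : C) (x : css) : cstar (a *: x) = a^* *: cstar x.
Proof. exact/css_inj/starZ. Qed.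
Let cstarM x y : cstar (cmul x y) = cmul (cstar y) (cstar x).
Proof. exact/css_inj/starM. Qed.
Let cstarK : involutive cstar.
Proof. by move=> *; apply/css_inj/starK. Qed.

HB.instance Definition _ := Lmodule_isStarAlgebra.Build C css
  cmulA cmulDl cmulDr cmulZl cmulZr cstarD cstarZ cstarM cstarK.

Let css_normM (x y : css) : `|x ** y| <= `|x| * `|y|.
Proof. exact: cstar_normM. Qed.

Let css_normS (x : css) : `|star x ** x| = `|x| ^+ 2.
Proof. exact: cstar_normS. Qed.

HB.instance Definition _ := isCStarNorm.Build C css css_normM css_normS.

End ClosedStarSubalgType.

(* The corestriction of [zeta] to the closure of its range extends to [U]; composed with the
   inclusion it is the identity by uniqueness. *)
Lemma universal_rep_dense (C : numClosedFieldType) (X : starAlgType C)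
    (U : cstarAlgType C) (zeta : X -> U) :
  universal_rep zeta -> closure (range zeta) = setT.
Proof.
move=> [hz univ]; apply/seteqP; split=> // u _.
have subX : star_subalgebra (range zeta).
  split; first split=> [|a _ _ [x _ <-] [y _ <-]].
  - by exists 0 => //; rewrite (shom0 hz).
  - by exists (a *: x + y) => //; rewrite (shomD hz) (shomZ hz).
  - by move=> _ _ [x _ <-] [y _ <-]; exists (x ** y) => //; rewrite (shomM hz).
  - by move=> _ [x _ <-]; exists (star x) => //; rewrite (shom_star hz).
pose S := ClosedStarSubalg (closure_star_subalgebra subX) (@closed_closure _ _).
have zS x : zeta x \in css_pred S.
  by apply/css_predP; apply: subset_closure; exists x.
pose z0 x : css S := Css (zS x).
have hz0 : star_hom z0.
  split=> [a x y|x y|x]; apply: (@val_inj _ _ (css S)) => /=.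
  - by rewrite (shomD hz) (shomZ hz).
  - exact: (shomM hz).
  - exact: (shom_star hz).
have [s [[hs sz] _]] := univ _ _ hz0.
have [i [_ iP]] := univ _ _ hz.
have e1 : i = id by apply: iP; split=> //; split.
have e2 : i = @css_val _ _ S \o s.
  apply: iP; split.
    by split=> [a x y|x y|x] /=; rewrite ?(shomD hs) ?(shomZ hs) ?(shomM hs) ?(shom_star hs).
  by apply/funext => x; have := congr1 (fun f => css_val (f x)) sz.
have -> : u = css_val (s u) by rewrite -[RHS]/((@css_val _ _ S \o s) u) -e2 e1.
exact: elimT (css_predP S _) (cssP _).
Qed.

(** * Polynomials acting by left multiplication *)

Section PolynomialAction.
Variables (C : numClosedFieldType) (X : starAlgType C).
Implicit Types (x y u v w : X) (p q r : {poly C}) (a c : C).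

(* The value at [x] of a polynomial without constant term is [pact x p x]. *)
Definition pact x p v : X := \sum_(i < size p) p`_i *: iter i (amul x) v.

Lemma pact_widen n x p v : (size p <= n)%N ->
  pact x p v = \sum_(i < n) p`_i *: iter i (amul x) v.
Proof.
move=> le_pn; rewrite /pact (big_ord_widen n (fun i => p`_i *: iter i (amul x) v)) //.
rewrite big_mkcond; apply: eq_bigr => i _; case: ltnP => // le_pi.
by rewrite nth_default // scale0r.
Qed.

Lemma pactD x p q v : pact x (p + q) v = pact x p v + pact x q v.
Proof.
pose n := maxn (size p) (size q).
rewrite (@pact_widen n _ p) ?leq_maxl // (@pact_widen n _ q) ?leq_maxr //.
rewrite (@pact_widen n) ?(leq_trans (size_polyD _ _)) // -big_split.
by apply: eq_bigr => i _; rewrite coefD scalerDl.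
Qed.

Lemma pactZ x a p v : pact x (a *: p) v = a *: pact x p v.
Proof.
rewrite (@pact_widen (size p)) ?size_scale_leq // scaler_sumr.
by apply: eq_bigr => i _; rewrite coefZ scalerA.
Qed.

Lemma pactC x c v : pact x c%:P v = c *: v.
Proof. by rewrite (@pact_widen 1) ?size_polyC_leq1 // big_ord1 coefC. Qed.

Lemma pactMX x p v : pact x (p * 'X) v = x ** pact x p v.
Proof.
rewrite (@pact_widen (size p).+1); last first.
  by rewrite (leq_trans (size_polyMleq _ _)) // size_polyX addn2.
rewrite big_ord_recl coefMX scale0r add0r amul_sumr.
by apply: eq_bigr => i _; rewrite coefMX /= amulZr.
Qed.

Lemma pactZr x p a v : pact x p (a *: v) = a *: pact x p v.
Proof.
rewrite /pact scaler_sumr; apply: eq_bigr => i _.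
rewrite [RHS]scalerA mulrC -scalerA; congr (_ *: _).
by elim: (i : nat) => //= k IH; rewrite IH amulZr.
Qed.

Lemma pact0r x p : pact x p 0 = 0.
Proof. by rewrite -(scale0r (0 : X)) pactZr !scale0r. Qed.

Lemma pact_amulr x p v w : pact x p (v ** w) = pact x p v ** w.
Proof.
elim/poly_ind: p => [|p c IH]; first by rewrite -polyC0 !pactC !scale0r amul0l.
by rewrite !pactD !pactMX !pactC IH amulDl amulA amulZl.
Qed.

Lemma pact_amull x p v : pact x p (x ** v) = x ** pact x p v.
Proof.
elim/poly_ind: p => [|p c IH]; first by rewrite -polyC0 !pactC !scale0r amul0r.
by rewrite !pactD !pactMX !pactC IH amulDr amulZr.
Qed.

Lemma pact_stable (P : set X) x p v : subspace P ->
  (forall y, P y -> P (x ** y)) -> P v -> P (pact x p v).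
Proof.
move=> sP hP Pv; apply: subspace_sum => // i; apply: subspaceZ => //.
by elim: (i : nat) => //= k; exact: hP.
Qed.

Lemma pact_self x p : pact x p x ** x = x ** pact x p x.
Proof. by rewrite -pact_amulr pact_amull. Qed.

Lemma star_pact_self x p : star x = x ->
  star (pact x p x) = pact x (map_poly (fun c => c^*) p) x.
Proof.
move=> sx; elim/poly_ind: p => [|p c IH].
  by rewrite map_poly0 -polyC0 !pactC !scale0r star0.
rewrite rmorphD rmorphM /= map_polyX map_polyC /= !pactD !pactMX !pactC.
by rewrite starD starZ starM sx IH pact_self.
Qed.

(** The annihilating polynomial is [p * 'X]: without a unit only polynomials with zero constant term
    can be evaluated. *)
Definition algebraic x := exists2 p, p != 0 & pact x p x = 0.

End PolynomialAction.

(** * Algebraicity in finite dimensional and locally matricial algebras *)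

Lemma iter_amul_hom (C : numClosedFieldType) (X Y : starAlgType C) (f : X -> Y)
    n x v : star_hom f ->
  f (iter n (amul x) v) = iter n (amul (f x)) (f v).
Proof. by move=> hf; elim: n => //= n <-; rewrite (shomM hf). Qed.

(** [lspan] allows arbitrarily many terms, with repetitions; collecting them into [size s]
    coefficients makes a dimension count possible. *)
Lemma lspan_seq (C : numClosedFieldType) (X : starAlgType C) (s : seq X) x :
  lspan [set` s] x -> exists c : 'I_(size s) -> C, x = \sum_i c i *: s`_i.
Proof.
apply: (@lspan_sub C X _ [set x | exists c : 'I_(size s) -> C,
                                    x = \sum_i c i *: s`_i]) => [|y /= sy].
  split=> [|a _ _ [c ->] [d ->]].
    by exists (fun=> 0); rewrite big1 // => i _; rewrite scale0r.
  exists (fun i => a * c i + d i); rewrite scaler_sumr -big_split.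
  by apply: eq_bigr => i _; rewrite scalerDl scalerA.
have lt_i : (index y s < size s)%N by rewrite index_mem.
exists (fun i => (i == Ordinal lt_i)%:R).
rewrite (bigD1 (Ordinal lt_i)) //= eqxx scale1r nth_index // big1 ?addr0 //.
by move=> i /negbTE ->; rewrite scale0r.
Qed.

(** The first [n.+1] powers of [x] lie in the span of [n] vectors, so their coefficient matrix has a
    nonzero left kernel vector, whose entries are the coefficients of [p]. *)
Lemma finite_dim_algebraic (C : numClosedFieldType) (X : starAlgType C) (x : X) :
  finite_dim X -> algebraic x.
Proof.
move=> [S [/finite_seqP[s ->] spanS]].
pose n := size s; pose v (i : nat) := iter i (amul x) x.
have /choice[M MP] : forall i : 'I_n.+1, exists c : 'I_n -> C,
    v i = \sum_j c j *: s`_j.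
  by move=> i; apply: lspan_seq; rewrite spanS.
pose A : 'M[C]_(n.+1, n) := \matrix_(i, j) M i j.
have kA0 : kermx A != 0.
  by rewrite -mxrank_eq0 mxrank_ker subn_eq0 -ltnNge ltnS rank_leq_col.
have [u u0 uA] : exists2 u : 'rV_n.+1, u != 0 & u *m A = 0.
  have [i ki0] : exists i, row i (kermx A) != 0.
    apply: contrapT => h; move/eqP: kA0; apply; apply/row_matrixP => i.
    by rewrite row0; apply/eqP; apply: contrapT => /negP hi; apply: h; exists i.
  by exists (row i (kermx A)) => //; apply/eqP; rewrite -sub_kermx row_sub.
pose p := \poly_(k < n.+1) u 0 (inord k).
have pE (k : 'I_n.+1) : p`_k = u 0 k by rewrite coef_poly ltn_ord inord_val.
exists p.
  apply: contraNneq u0 => p0; apply/eqP/rowP => k.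
  by rewrite -pE p0 coef0 mxE.
rewrite (@pact_widen _ _ n.+1) ?size_poly //.
under eq_bigr => k _ do rewrite -/(v k) pE MP scaler_sumr.
rewrite exchange_big big1 // => j _.
under eq_bigr => k _ do rewrite scalerA.
rewrite -scaler_suml; have := congr1 (fun B : 'rV_n => B 0 j) uA.
rewrite !mxE => h; rewrite [X in X *: _](_ : _ = 0) ?scale0r // -[RHS]h.
by apply: eq_bigr => k _; rewrite mxE.
Qed.

Lemma locally_matricial_algebraic (C : numClosedFieldType) (X : starAlgType C)
    (S : set X) x : locally_matricial S -> S x -> algebraic x.
Proof.
move=> lS Sx; have [M [[D [f [hf _ <- fdD]]] _ /(_ ord0)[d _ dx]]] :=
  lS 1%N (fun=> x) (fun=> Sx).
have [p p0 hp] := @finite_dim_algebraic C D d fdD.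
exists p => //; rewrite -dx; have := congr1 f hp; rewrite (shom0 hf) => <-.
rewrite (shom_sum hf); apply: eq_bigr => i _.
by rewrite (shomZ hf) (iter_amul_hom _ _ _ hf).
Qed.

(** * Support projections of algebraic elements *)

(* A polynomial splits as [q * 'X^m] with [q] invertible at [0], and in a C*-algebra the
   factor ['X^m] of an annihilating polynomial of a self-adjoint element can be cancelled. *)
Section Support.
Variables (C : numClosedFieldType) (X : starAlgType C) (U : cstarAlgType C).
Variables (zeta : X -> U).
Hypotheses (zhom : star_hom zeta) (zinj : injective zeta).
Implicit Types (x y a e p q : X).

Lemma star_amul_eq0_inj x : star x ** x = 0 -> x = 0.
Proof.
move=> h; apply: zinj; rewrite (shom0 zhom); apply: star_amul_eq0.
by rewrite -(shom_star zhom) -(shomM zhom) h (shom0 zhom).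
Qed.

Lemma pact_cancelX a (p : {poly C}) k : star a = a ->
  pact a (p * 'X^k) a = 0 -> pact a p a = 0.
Proof.
move=> sa; elim: k => [|k IH]; first by rewrite mulr1.
rewrite exprSr mulrA pactMX => h; apply: IH.
(* For [z = pact a q a], the product [star z ** z] is a polynomial in [a] acting on [a ** z], which
   vanishes by [h]. *)
set q := p * 'X^k in h *; apply: star_amul_eq0_inj.
by rewrite (star_pact_self _ sa) -pact_amulr h pact0r.
Qed.

Lemma selfadjoint_unit a : star a = a -> algebraic a ->
  exists e, [/\ projection e, e ** a = a, exists r, e = pact a r a
             & exists g, e = a ** g].
Proof.
move=> sa [p p0 pa].
have [m [q q0 pE]] := multiplicity_XsubC p 0; rewrite p0 /= subr0 in q0 pE.
have {pa} : pact a q a = 0 by apply: (@pact_cancelX _ _ m) => //; rewrite -pE.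
(* The relation becomes [a ** pact a r a = - (q.[0] *: a)] with [q.[0]] nonzero, so rescaling [r]
   yields a unit for [a]. *)
have [r qE] : exists r, q = r * 'X + (q.[0])%:P.
  have /factor_theorem[r rE] : root (q - (q.[0])%:P) 0.
    by rewrite rootE !hornerE subrr.
  by exists r; rewrite -[X in r * X]subr0 -rE subrK.
rewrite {1}qE pactD pactMX pactC => /eqP; rewrite addr_eq0 => /eqP ae.
pose s := - (q.[0])^-1 *: r; pose e := pact a s a.
have ea : a ** e = a.
  rewrite /e /s scaleNr -scaleN1r !pactZ !amulZr ae scaleN1r !scalerN opprK.
  by rewrite scalerA mulVf // scale1r.
have ea' : e ** a = a by rewrite /e pact_self.
have ee : e ** e = e by rewrite {1}/e -pact_amulr ea.
(* [star e] is also a polynomial in [a] without constant term, so it absorbs [e]; thus [star e]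
   equals the self-adjoint element [star e ** e]. *)
have se : star e ** e = star e.
  by rewrite {1}/e star_pact_self // -pact_amulr ea -star_pact_self.
have sE : star e = e by rewrite -{2}[e]starK -se starM starK se.
exists e; split=> //; first by exists s.
by exists (pact a s e); rewrite -pact_amull ea.
Qed.

(** The unit [e] of [star y ** y] satisfies [star y ** (y - y ** e) = 0], hence [star z ** z = 0]
    for [z = y - y ** e]. *)
Lemma right_support y : algebraic (star y ** y) ->
  exists e, [/\ projection e, y ** e = y,
    exists r, e = pact (star y ** y) r (star y ** y)
    & exists g, e = g ** y].
Proof.
have sa : star (star y ** y) = star y ** y by rewrite starM starK.
move=> /(selfadjoint_unit sa)[e [[se ee] ea er [g eg]]].
exists e; split=> //; last first.
  by exists (star g ** star y); rewrite -[LHS]se eg starM sa amulA.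
have ae : star y ** y ** e = star y ** y by rewrite -[RHS]sa -[in RHS]ea starM sa se.
apply/eqP; rewrite eq_sym -subr_eq0; apply/eqP/star_amul_eq0_inj.
have z0 : star y ** (y - y ** e) = 0 by rewrite amulBr amulA ae subrr.
by rewrite starB starM amulBl z0 -amulA z0 amul0r subrr.
Qed.

End Support.

(** * Geometric convergence *)

Section GeometricBounds.
Variable R : realType.
Local Notation C := R[i].

(** A positive complex number is real, which reduces the claim to the Archimedean property of
    [R]. *)
Lemma exp_half_lt (e : C) : 0 < e -> exists n, 2%:R^-1 ^+ n < e.
Proof.
case: e => e e'; rewrite ltcE /= => /andP[/eqP -> e0].
pose n := Num.bound e^-1; exists n.
have lt_n : e^-1 < 2%:R ^+ n.
  apply: lt_trans (archi_boundP (ltW _)) _; first by rewrite invr_gt0.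
  by rewrite -natrX ltr_nat ltn_expl.
have -> : 2%:R^-1 ^+ n = ((2%:R ^+ n)^-1)%:C%C :> C.
  by rewrite -exprVn rmorphXn /= fmorphV rmorph_nat.
by rewrite ltcR -[ltRHS]invrK ltf_pV2 // posrE ?exprn_gt0 // invr_gt0.
Qed.

Lemma geometric_cauchy (U : completeNormedModType C) (t : nat -> U) (c : C) :
  0 < c -> (forall n, `|t n.+1 - t n| <= c * 2%:R^-1 ^+ n) ->
  exists l, forall n, `|l - t n| <= (c + c + 1) * 2%:R^-1 ^+ n.
Proof.
move=> c0 ht; pose h n : C := 2%:R^-1 ^+ n.
have h0 n : 0 < h n by rewrite exprn_gt0 // invr_gt0 ltr0n.
have hS n : h n.+1 + h n.+1 = h n.
  by rewrite /h exprSr -mulrDr -[RHS]mulr1 [X in _ = _ * X](splitr 1) div1r.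
have hle m n : (m <= n)%N -> `|t n - t m| <= (c + c) * h m.
  move=> /subnK <-; set k := (n - m)%N.
  (* The subtracted tail makes the induction work: by [hS] the right side grows by exactly
     [c * h (k + m)] from [k] to [k.+1]. *)
  suff : `|t (k + m)%N - t m| <= (c + c) * h m - (c + c) * h (k + m)%N.
    move=> /le_trans; apply; rewrite gerBl mulr_ge0 ?ltW // addr_gt0 //.
  elim: k => [|k IH]; first by rewrite add0n !subrr normr0.
  rewrite addSn -(subrKA (t (k + m)%N)); apply: le_trans (ler_normD _ _) _.
  apply: le_trans (lerD (ht _) IH) _; rewrite -/(h _).
  by rewrite -(hS (k + m)%N) le_eqVlt; apply/orP; left; apply/eqP; ring.
have tc : cauchy (t @ \oo).
  apply/cauchyP => e e0.
  have [m lt_m] : exists m, h m < e / (c + c) by apply/exp_half_lt/divr_gt0/addr_gt0.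
  exists (t m).
  have : \forall n \near \oo, (m <= n)%N by exact: nbhs_infty_ge.
  apply: filterS => n le_mn; rewrite -ball_normE /= distrC.
  apply: le_lt_trans (hle _ _ le_mn) _.
  by rewrite mulrC -ltr_pdivlMr // addr_gt0.
have /cvgrPdist_lt tl : t @ \oo --> lim (t @ \oo) by apply: cauchy_cvg.
exists (lim (t @ \oo)) => m.
(* The summand [1] of the constant pays for the distance from a late term [t n] to the limit. *)
have : \forall n \near \oo, (m <= n)%N by exact: nbhs_infty_ge.
have := tl _ (h0 m) => /filterI/[apply]/filter_ex[n [ln le_mn]].
rewrite -(subrKA (t n)); apply: le_trans (ler_normD _ _) _.
by rewrite mulrDl mul1r addrC lerD // ?hle // ltW.
Qed.

End GeometricBounds.

(** * Closedness of a sum of closed ideals *)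

Section ClosedSum.
Variables (R : realType) (U : cstarAlgType R[i]).
Implicit Types (P Q : set U) (x i e : U).

(* [i + j = ((i + j) e + (i - i e)) + (j - j e)], where the first summand has norm close to
   that of [i + j] if [e] is an approximate unit; hence an approximating sequence in
   [P + Q] can be split into convergent sequences in [P] and in [Q]. *)
Lemma closed_set_sum P Q : ideal setT P -> ideal setT Q -> closed P -> closed Q ->
  (forall i, P i -> forall d : R[i], 0 < d ->
     exists e, [/\ P e, `|e| <= 1 & `|i - i ** e| < d]) ->
  closed (set_sum P Q).
Proof.
move=> iP iQ cP cQ unitP.
have sP : subspace P by case: iP.
have sQ : subspace Q by case: iQ.
have split_sum x (d : R[i]) : set_sum P Q x -> 0 < d ->
    exists i, [/\ P i, Q (x - i) & `|i| <= `|x| + d].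
  move=> [i Pi [j Qj <-]] d0; have [e [Pe e1 ie]] := unitP _ Pi _ d0.
  exists ((i + j) ** e + (i - i ** e)); split.
  - apply: subspaceD => //; first exact: ideal_amull.
    by apply: subspaceB => //; exact: ideal_amull.
  - have -> : i + j - ((i + j) ** e + (i - i ** e)) = j - j ** e.
      rewrite amulDl [_ + j ** e]addrC [_ + (i - _)]addrC addrACA addNr addr0.
      by rewrite opprD addrACA subrr add0r.
    by apply: subspaceB => //; exact: ideal_amulr.
  - apply: le_trans (ler_normD _ _) _; apply: lerD; last exact: ltW.
    by apply: le_trans (cstar_normM _ _) _; rewrite ler_piMr.
move=> x /closureP hx; pose h n : R[i] := 2%:R^-1 ^+ n.
have h0 n : 0 < h n by rewrite exprn_gt0 // invr_gt0 ltr0n.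
have /choice[s sE] : forall n, exists s, set_sum P Q s /\ `|x - s| < h n.
  by move=> n; have [s] := hx _ (h0 n); exists s.
have sumB y z : set_sum P Q y -> set_sum P Q z -> set_sum P Q (y - z).
  move=> [i Pi [j Qj <-]] [k Pk [l Ql <-]].
  exists (i - k); first exact: subspaceB.
  by exists (j - l); [exact: subspaceB|rewrite opprD addrACA].
(* Consecutive approximants differ by at most [h n + h n.+1], which is below twice [h n]; the
   splitting costs one more [h n]. *)
have /choice[u uE] : forall n, exists i, [/\ P i, Q (s n.+1 - s n - i) & `|i| <= 3%:R * h n].
  move=> n; have [i [Pi Qi le_i]] := split_sum _ _ (sumB _ _ (sE n.+1).1 (sE n).1) (h0 n).
  exists i; split=> //; apply: le_trans le_i _.
  rewrite -natr1 mulrDl mul1r lerD // -natr1 mulrDl mul1r.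
  rewrite -(subrKA x) addrC; apply: le_trans (ler_normD _ _) _.
  apply: lerD; first exact: ltW (sE n).2.
  rewrite distrC; apply: le_trans (ltW (sE n.+1).2) _.
  by rewrite /h exprSr ler_piMr ?(ltW (h0 n)) // invf_le1 ?ltr0n // ler1n.
have [a Pa [b Qb abE]] := (sE 0%N).1.
(* The [P]-parts of the increments are summed, leaving [s n - t n] in [Q]; if [t] tends to [l], then
   [x = l + (x - l)] is the required splitting. *)
pose t n := a + \sum_(k < n) u k.
have Pt n : P (t n) by apply: subspaceD => //; apply: subspace_sum => // k; case: (uE k).
have Qt n : Q (s n - t n).
  rewrite /t; elim: n => [|n IH]; first by rewrite big_ord0 addr0 -abE addrC addKr.
  rewrite big_ord_recr /= addrA opprD addrA.
  have -> : s n.+1 - (a + \sum_(k < n) u k) - u n =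
            (s n.+1 - s n - u n) + (s n - (a + \sum_(k < n) u k)).
    by rewrite [s n.+1 - s n - u n]addrAC subrKA addrAC.
  by apply: subspaceD => //; case: (uE n).
have [|n|l tl] := @geometric_cauchy R U t 3%:R; first by rewrite ltr0n.
  rewrite /t big_ord_recr /= addrA [X in `|X|]addrC addKr.
  by case: (uE n).
have small M : 0 < M -> forall e : R[i], 0 < e -> exists n, M * h n < e.
  move=> M0 e e0; have [n lt_n] := exp_half_lt (divr_gt0 e0 M0).
  by exists n; rewrite mulrC -ltr_pdivlMr.
exists l.
  apply: cP; apply/closureP => e e0.
  have [|n lt_n] := small (3%:R + 3%:R + 1) _ e e0.
    by rewrite !addr_gt0 // ltr0n.
  by exists (t n) => //; exact: le_lt_trans (tl n) lt_n.
exists (x - l); last by rewrite addrC subrK.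
apply: cQ; apply/closureP => e e0.
have [|n lt_n] := small (1 + (3%:R + 3%:R + 1)) _ e e0.
  by rewrite !addr_gt0 // ltr0n.
exists (s n - t n) => //; apply: le_lt_trans lt_n.
rewrite opprB [t n - s n]addrC addrACA [- l + _]addrC -opprB.
apply: le_trans (ler_normD _ _) _.
rewrite normrN mulrDl mul1r.
by apply: lerD; rewrite distrC; [apply: ltW; case: (sE n)|exact: tl].
Qed.

End ClosedSum.

(** * Words span the free algebra *)

Section FreeWords.
Variables (C : numClosedFieldType) (A : choiceType).
Implicit Types (l k : letter A) (s u v w : word A) (f g : freeAlg C A).

Definition free_letter l : freeAlg C A :=
  match l with inl a => free_gen C a | inr a => star (free_gen C a) end.

Definition free_word l s : freeAlg C A :=
  foldl (fun x k => x ** free_letter k) (free_letter l) s.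

Lemma coef_free_letter l w : free_coef (free_letter l) w = `[< w = [:: l] >]%:R.
Proof.
case: l => a //=; rewrite conjC_nat; congr (_%:R); congr nat_of_bool.
apply/asbool_equiv_eq; split=> [h|-> //].
by rewrite -[w]word_starK h.
Qed.

(** In the convolution only the cut after [size u] letters can contribute. *)
Lemma coef_delta_mul f g u v :
    (forall w, free_coef f w = `[< w = u >]%:R) ->
    (forall w, free_coef g w = `[< w = v >]%:R) ->
  forall w, free_coef (f ** g) w = `[< w = u ++ v >]%:R.
Proof.
move=> fu gv w; rewrite [LHS]/= /conv.
under eq_bigr => i _ do rewrite fu gv.
case: asboolP => [->|wuv]; last first.
  rewrite big1 // => i _; case: asboolP => [h1|_]; last by rewrite mul0r.
  case: asboolP => [h2|_]; last by rewrite mulr0.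
  by case: wuv; rewrite -h1 -h2 cat_take_drop.
have lt_u : (size u < (size (u ++ v)).+1)%N by rewrite ltnS size_cat leq_addr.
rewrite (bigD1 (Ordinal lt_u)) //= take_size_cat // drop_size_cat //.
rewrite !asboolT // mulr1 big1 ?addr0 // => i /eqP ne_i.
rewrite asboolF ?mul0r // => h; apply: ne_i; apply: val_inj => /=.
by rewrite -[in RHS]h size_takel // -ltnS.
Qed.

Lemma coef_free_word l s w : free_coef (free_word l s) w = `[< w = l :: s >]%:R.
Proof.
elim/last_ind: s w => [|s k IH] w; first exact: coef_free_letter.
rewrite /free_word foldl_rcons -/(free_word l s) -rcons_cons -cats1.
by apply: coef_delta_mul => // v; exact: coef_free_letter.
Qed.

Lemma free_word_span f : lspan [set x | exists l s, x = free_word l s] f.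
Proof.
have [s sE] := (finite_seqP _).1 (free_coef_fin f).
(* The empty word gets the default [0], which is harmless because the coefficient of [f] there is
   [0]. *)
pose m w : freeAlg C A := if w is l :: r then free_word l r else 0.
have -> : f = \sum_(w <- undup s) free_coef f w *: m w.
  apply: free_coefP => w.
  have -> (r : seq (word A)) : free_coef (\sum_(w <- r) free_coef f w *: m w) w =
      \sum_(v <- r) free_coef f v * free_coef (m v) w.
    by elim: r => [|v r IH]; rewrite ?big_nil // !big_cons -IH.
  have mE v : free_coef f v * free_coef (m v) w = if v == w then free_coef f w else 0.
    case: v => [|l r] /=.
      by rewrite free_coef_nil mul0r; case: eqP => // <-; rewrite free_coef_nil.
    rewrite coef_free_word; case: eqP => [<-|ne]; first by rewrite asboolT // mulr1.
    by rewrite asboolF ?mulr0 // => h; apply: ne.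
  under eq_bigr => v _ do rewrite mE.
  rewrite -big_mkcond big_const_seq /=.
  have [w0|w0] := eqVneq (free_coef f w) 0.
    by rewrite w0; elim: (count _ _) => //= n <-; rewrite addr0.
  have ws : w \in s by have : [set` s] w by rewrite -sE.
  by rewrite count_uniq_mem ?undup_uniq // mem_undup ws /= addr0.
elim/big_ind: _ => [|x y|w _]; first by case: (lspan_subspace [set x | exists l s, x = free_word l s]).
  by apply: subspaceD; exact: lspan_subspace.
apply: subspaceZ; first exact: lspan_subspace.
case: w => [|l r] /=; first by case: (lspan_subspace [set x | exists l s, x = free_word l s]).
by apply: sub_lspan; exists l, r.
Qed.

End FreeWords.

(** * The core, balance of products, and the ideal generated by a subset of the core *)

Section Core.
Variables (C : numClosedFieldType) (A : choiceType).
Variables (I : starIdeal (freeAlg C A)) (H : torusSubgroup C A).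
Hypothesis pA : property_A I H.
Local Notation X := (quot I).
Local Notation W := (@words C A I).
Local Notation W0 := (@words_bal C A I H 0).
Implicit Types (x y : X) (S J : set X).

Lemma words_span : lspan W = setT.
Proof.
apply/seteqP; split=> // q _; rewrite -[q]reprK.
have [n [c [w [wW ->]]]] := free_word_span (repr q).
have hpi := quot_pi_hom I; rewrite -/(quot_pi I _) (shom_sum hpi).
apply: subspace_sum; first exact: lspan_subspace.
move=> i; rewrite (shomZ hpi); apply: subspaceZ; first exact: lspan_subspace.
apply: sub_lspan; have [l [s ->]] := wW i; exists l, s.
have hl k : quot_pi I (free_letter C k) = letter_val I k.
  by case: k => a //=; rewrite (shom_star hpi).
elim/last_ind: s => [|s k IH]; first exact: hl.
by rewrite word_val_rcons -IH -hl -(shomM hpi) /free_word foldl_rcons.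
Qed.

Lemma core_subspace : subspace (core I H).
Proof. exact: lspan_subspace. Qed.

Lemma words_bal_core x : W0 x -> core I H x.
Proof. exact: sub_lspan. Qed.

Lemma coreM x y : core I H x -> core I H y -> core I H (x ** y).
Proof.
apply: lspan_bilin; first exact: core_subspace.
move=> u v [uW u0 bu] [vW v0 bv]; have [->|uv0] := eqVneq (u ** v) 0.
  by case: core_subspace.
apply: words_bal_core; split=> //; first exact: wordsM.
by rewrite balM // bu bv addr0.
Qed.

Lemma core_star x : core I H x -> core I H (star x).
Proof.
move=> [n [c [w [wW ->]]]]; rewrite star_sum.
apply: subspace_sum; first exact: core_subspace.
move=> i; rewrite starZ; apply: subspaceZ; first exact: core_subspace.
apply: words_bal_core; have [iW i0 bi] := wW i; split.
- exact: words_star.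
- by apply: contraNneq i0 => h; rewrite -[w i]starK h star0.
- by rewrite bal_star // bi oppr0.
Qed.

Lemma core_pact x p : core I H x -> core I H (pact x p x).
Proof.
by move=> cx; apply: pact_stable => // [|y]; [exact: core_subspace|exact: coreM].
Qed.

Lemma words_sandwich x y u : W x -> W y -> x != 0 -> y != 0 -> W0 u ->
  x ** u ** y = 0 \/
  [/\ W (x ** u ** y), x ** u ** y != 0 & bal H (x ** u ** y) = bal H x + bal H y].
Proof.
move=> xW yW x0 y0 [uW u0 bu].
have [->|xuy0] := eqVneq (x ** u ** y) 0; [by left|right].
have xu0 : x ** u != 0 by apply: contraNneq xuy0 => ->; rewrite amul0l.
split=> //; first exact/wordsM/yW/wordsM.
by rewrite !balM ?bu ?addr0 //; exact: wordsM.
Qed.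

(** These are exactly the words to which property (C') applies; a word equal to [0] is among them,
    since [words_bal] contains only nonzero words. *)
Definition unbalanced : set X := [set x | W x /\ ~ W0 x].

Lemma lspan_sandwich S (P : set X) x y : subspace P ->
  (forall u, S u -> P (x ** u ** y)) -> forall u, lspan S u -> P (x ** u ** y).
Proof.
move=> sP hP; apply: (@lspan_sub C X S [set u | P (x ** u ** y)]) => //.
split=> [|a u v /= Pu Pv]; first by rewrite /= amul0r amul0l; case: sP.
by rewrite amulDr amulZr amulDl amulZl; case: sP => _; exact.
Qed.

Lemma balanced_sandwich_core x y u : W x -> W y ->
    (x != 0 -> y != 0 -> bal H x + bal H y = 0) ->
  core I H u -> core I H (x ** u ** y).
Proof.
move=> xW yW b0; have c0 := core_subspace.1.
have [->|x0] := eqVneq x 0; first by rewrite !amul0l.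
have [->|y0] := eqVneq y 0; first by rewrite !amul0r.
apply: lspan_sandwich; first exact: core_subspace.
move=> v /(words_sandwich xW yW x0 y0)[->//|[vW v0 bv]].
by apply: words_bal_core; split=> //; rewrite bv b0.
Qed.

Lemma word_conj_core x u : W x -> core I H u -> core I H (star x ** u ** x).
Proof.
move=> xW; apply: balanced_sandwich_core => //; first exact: words_star.
by move=> _ x0; rewrite bal_star // addNr.
Qed.

Lemma word_norm_core x : W x -> core I H (star x ** x).
Proof.
move=> xW; have [->|xx0] := eqVneq (star x ** x) 0; first by case: core_subspace.
have x0 : x != 0 by apply: contraNneq xx0 => ->; rewrite amul0r.
have sW := words_star xW; apply: words_bal_core; split=> //; first exact: wordsM.
by rewrite balM // bal_star // addNr.
Qed.

(** Core elements have balance [0], so the alternative is decided by [bal H x + bal H y] alone,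
    uniformly in [u]. *)
Lemma sandwich_core_or_unbalanced x y : W x -> W y ->
  (forall u, core I H u -> core I H (x ** u ** y)) \/
  (forall u, core I H u -> lspan unbalanced (x ** u ** y)).
Proof.
move=> xW yW; have [b0|/eqP b0] := eqVneq (bal H x + bal H y) 0.
  by left=> u; exact: balanced_sandwich_core.
have [x0|x0] := eqVneq x 0.
  by left=> u; apply: balanced_sandwich_core => //; rewrite x0 eqxx.
have [y0|y0] := eqVneq y 0.
  by left=> u; apply: balanced_sandwich_core => //; rewrite y0 eqxx.
have sU := lspan_subspace unbalanced.
right; apply: lspan_sandwich => // u /(words_sandwich xW yW x0 y0)[->|[uW u0 bu]].
  exact: sU.1.
by apply: sub_lspan; split=> // -[_ _]; rewrite bu.
Qed.

(* Products with a word on both sides suffice: when [J] is contained in the core, each [j] in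
   [J] is [e j f] with [e, f] in the core. *)
Definition sandwich J : set X :=
  lspan [set z | exists x j y, [/\ W x, J j, W y & z = x ** j ** y]].

Lemma sandwich_subspace J : subspace (sandwich J).
Proof. exact: lspan_subspace. Qed.

Lemma sandwich_ideal J : ideal setT (sandwich J).
Proof.
split=> //; first exact: sandwich_subspace.
move=> b z _; have : lspan W b by rewrite words_span.
move=> Wb Jz; split.
  apply: lspan_bilin Wb Jz; first exact: sandwich_subspace.
  move=> u _ uW [x [j [y [xW Jj yW ->]]]]; apply: sub_lspan.
  by exists (u ** x), j, y; split=> //; [exact: wordsM|rewrite !amulA].
apply: lspan_bilin Jz Wb; first exact: sandwich_subspace.
move=> _ u [x [j [y [xW Jj yW ->]]]] uW; apply: sub_lspan.
by exists x, j, (y ** u); split=> //; [exact: wordsM|rewrite !amulA].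
Qed.

Lemma sandwich_min J P : ideal setT P -> J `<=` P -> sandwich J `<=` P.
Proof.
move=> hP JP; apply: lspan_sub; first by case: hP.
by move=> _ [x [j [y [_ /JP Pj _ ->]]]]; apply: ideal_amulr => //; exact: ideal_amull.
Qed.

Lemma core_sandwich J j e f : J j -> core I H e -> core I H f ->
  sandwich J (e ** j ** f).
Proof.
move=> Jj Ae Af.
have mono S T : S `<=` T -> lspan S `<=` @lspan C X T.
  by move=> ST; apply: lspan_sub; [exact: lspan_subspace|move=> x /ST; exact: sub_lspan].
have {}Ae : lspan W e by rewrite words_span.
have {}Af : lspan W f by rewrite words_span.
pose T := [set z | exists2 x, W x & z = x ** j].
have Tej : lspan T (e ** j).
  apply: (@lspan_bilin C X W [set j]) Ae _; first exact: lspan_subspace.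
    by move=> x _ xW ->; apply: sub_lspan; exists x.
  exact: sub_lspan.
apply: (@lspan_bilin C X T W) Tej Af; first exact: sandwich_subspace.
by move=> _ y [x xW ->] yW; apply: sub_lspan; exists x, j, y.
Qed.

(** Each spanning product [x ** j ** y] lies entirely in the core or entirely in the unbalanced
    span, so [k] can be a combination of such products and stays in the ideal. *)
Lemma sandwich_decomp J z : J `<=` core I H -> sandwich J z ->
  exists k w, [/\ core I H k, sandwich J k, lspan unbalanced w & z = k + w].
Proof.
move=> JA; apply: (@lspan_sub C X _ [set z | exists k w,
  [/\ core I H k, sandwich J k, lspan unbalanced w & z = k + w]]).
  split=> [|a _ _ [k [w [Ak Jk Ww ->]]] [k' [w' [Ak' Jk' Ww' ->]]]].
    exists 0, 0; rewrite addr0; split=> //; first by case: core_subspace.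
      by case: (sandwich_subspace J).
    by case: (lspan_subspace unbalanced).
  exists (a *: k + k'), (a *: w + w'); split.
  - exact: core_subspace.2.
  - exact: (sandwich_subspace J).2.
  - exact: (lspan_subspace unbalanced).2.
  - by rewrite scalerDr addrACA.
move=> _ [x [j [y [xW Jj yW ->]]]].
have Jz : sandwich J (x ** j ** y) by apply: sub_lspan; exists x, j, y.
have [h|h] := sandwich_core_or_unbalanced xW yW; have := h _ (JA _ Jj) => {}h.
  by exists (x ** j ** y), 0; rewrite addr0; split=> //; case: (lspan_subspace unbalanced).
exists 0, (x ** j ** y); rewrite add0r; split=> //; first by case: core_subspace.
by case: (sandwich_subspace J).
Qed.

(** Property (C') is applied to one word after the other, each time below the previous projection;
    compressions that already vanish remain zero under a smaller projection. *)
Lemma cut_unbalanced w e : property_C' I H -> lspan unbalanced w ->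
    core I H e -> projection e -> e != 0 ->
  exists p, [/\ core I H p, projection p, p != 0, proj_le p e & p ** w ** p = 0].
Proof.
move=> pC [n [c [v [vW ->]]]] {w} Ae pe e0.
suff [p [Ap pp p0 le_pe hp]] : exists p, [/\ core I H p, projection p, p != 0, proj_le p e
    & forall i, p ** v i ** p = 0].
  exists p; split=> //; rewrite amul_sumr amul_suml big1 // => i _.
  by rewrite amulZr amulZl hp scaler0.
elim: n v vW {c} => [|n IH] v vW.
  by exists e; split=> //; [exact: pe.2|case].
have [p [Ap pp p0 le_pe hp]] := IH (fun i => v (lift ord0 i)) (fun i => vW _).
have [W1 W2] := vW ord0; have [q [Aq pq q0 le_qp hq]] := pC _ W1 W2 _ Ap pp p0.
exists q; split=> //; first by rewrite /proj_le -le_qp -amulA le_pe.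
move=> i; case: (unliftP ord0 i) => [j|] ->; last exact: hq.
have -> : q ** v (lift ord0 j) ** q = q ** (p ** v (lift ord0 j) ** p) ** q.
  by rewrite !amulA le_qp -(amulA _ p q) (projection_leE pq pp le_qp).
by rewrite hp amul0r amul0l.
Qed.

End Core.

(** * Closed ideals generated by images under [zeta] *)

Section ClosedIdeals.
Variables (C : numClosedFieldType) (X : starAlgType C) (U : cstarAlgType C).
Variable (zeta : X -> U).
Implicit Types (J K : set X).

(** The image of [J] absorbs only multiplication by the range of [zeta]; density of the range and
    [closure_amul] extend this to all of [U]. *)
Lemma closure_image_ideal J : star_hom zeta -> closure (range zeta) = setT ->
  ideal setT J -> closed_ideal (closure (zeta @` J)).
Proof.
move=> hz dense iJ; have [_ [J0 sJ] _] := iJ.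
split; last exact: closed_closure.
split=> // [|b x _ Jx].
  apply: closure_subspace; split; first by exists 0 => //; rewrite (shom0 hz).
  move=> a _ _ [x Jx <-] [y Jy <-]; exists (a *: x + y); first exact: sJ.
  by rewrite (shomD hz) (shomZ hz).
have rb : closure (range zeta) b by rewrite dense.
split; [apply: (closure_amul _ rb Jx)|apply: (closure_amul _ Jx rb)].
  move=> _ _ [x' _ <-] [y Jy <-]; exists (x' ** y); first exact: ideal_amull.
  by rewrite (shomM hz).
move=> _ _ [y Jy <-] [x' _ <-]; exists (y ** x'); first exact: ideal_amulr.
by rewrite (shomM hz).
Qed.

(** A closed ideal of [U] containing the image of [J] pulls back to an ideal containing [J], hence
    containing [K] by minimality. *)
Lemma Phi_closure J K : star_hom zeta -> closure (range zeta) = setT ->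
    ideal setT K -> J `<=` K -> (forall P, ideal setT P -> J `<=` P -> K `<=` P) ->
  Phi zeta J = closure (zeta @` K).
Proof.
move=> hz dense iK JK minK; apply/seteqP; split=> u.
  apply; split; first exact: closure_image_ideal.
  by move=> _ [x /JK Kx <-]; apply: subset_closure; exists x.
move=> Ku D /= [[iD cD] JD]; apply: cD; apply: closureS Ku => _ [x Kx <-].
have := minK (zeta @^-1` D) (shom_preimage_ideal hz iD); apply=> //.
by move=> y Jy; apply: JD; exists y.
Qed.

Lemma sub_Phi J x : J x -> Phi zeta J (zeta x).
Proof. by move=> Jx D [_]; apply; exists x. Qed.

Lemma Phi_min J D : closed_ideal D -> J `<=` zeta @^-1` D -> Phi zeta J `<=` D.
Proof. by move=> cD JD u; apply; split=> // _ [x /JD Dx <-]. Qed.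

Lemma PhiS J K : J `<=` K -> Phi zeta J `<=` Phi zeta K.
Proof.
by move=> JK u Ju D [cD KD]; apply: Ju; split=> // _ [x /JK Kx <-]; apply: KD; exists x.
Qed.

End ClosedIdeals.

(** * Supports in the core, closures of generated ideals, and local units *)

Section CuntzKrieger.
Variables (C : numClosedFieldType) (A : choiceType).
Variables (I : starIdeal (freeAlg C A)) (H : torusSubgroup C A).
Variables (U : cstarAlgType C) (zeta : quot I -> U).
Hypotheses (pA : property_A I H) (pB : property_B I H) (pC : property_C' I H).
Hypotheses (zhom : star_hom zeta) (zinj : injective zeta).
Local Notation X := (quot I).
Local Notation W := (@words C A I).
Implicit Types (x y e f p : X) (J P : set X).

(** Only [star y ** y] is required to be in the core, so that this also covers products
    [x ** j ** y] with unbalanced words [x] and [y]. *)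
Lemma core_right_support y : core I H (star y ** y) ->
  exists e, [/\ core I H e, projection e, y ** e = y & exists g, e = g ** y].
Proof.
move=> cy; have ay := locally_matricial_algebraic pB cy.
have [e [pe ye [r er] eg]] := right_support zhom zinj ay.
by exists e; split=> //; rewrite er; exact: core_pact.
Qed.

Lemma core_left_support x : core I H x ->
  exists e, [/\ core I H e, projection e, e ** x = x & exists g, e = x ** g].
Proof.
move=> cx; have cxx : core I H (star (star x) ** star x).
  by rewrite starK; apply: coreM => //; exact: core_star.
have [e [ce pe xe [g eg]]] := core_right_support cxx; have [se _] := pe.
exists e; split=> //; first by rewrite -{2}[x]starK -xe starM se starK.
by exists (star g); rewrite -se eg starM starK.
Qed.

Lemma sub_sandwich J : J `<=` core I H -> J `<=` sandwich J.
Proof.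
move=> JA j Jj; have cj := JA _ Jj.
have [e [ce _ ej _]] := core_left_support cj.
have [|f [cf _ jf _]] := @core_right_support j.
  by apply: coreM => //; exact: core_star.
by rewrite -jf -{1}ej; exact: (core_sandwich Jj ce cf).
Qed.

(** Modulo [P], [d] is the idempotent [e], and all positive powers of an idempotent coincide. *)
Lemma pact_modulo_ideal P d e (q : {poly C}) : ideal setT P ->
  e ** e = e -> P (d - e) -> P (pact d q d - q.[1] *: e).
Proof.
move=> iP ee Pde; have sP : subspace P by case: iP.
elim/poly_ind: q => [|q c IH].
  by rewrite -polyC0 pactC hornerC !scale0r subrr; case: sP.
rewrite pactD pactMX pactC !hornerE.
have -> : d ** pact d q d + c *: d - (q.[1] + c) *: e =
    d ** (pact d q d - q.[1] *: e) + (q.[1] *: ((d - e) ** e) + c *: (d - e)).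
  rewrite amulBr amulZr amulBl ee !scalerBr scalerDl opprD addrACA.
  by rewrite [RHS]addrA subrKA.
apply: subspaceD => //; first exact: ideal_amull.
apply: subspaceD => //; apply: subspaceZ => //; exact: ideal_amulr.
Qed.

(* If [d] had the eigenvalue [1], property (C') would compress [d - w] to a nonzero
   projection, although [d - w] is a strict contraction. *)
Lemma core_fixed_eq0 d w v : core I H d -> lspan (@unbalanced C A I H) w ->
  `|zeta (d - w)| < 1 -> core I H v -> d ** v = v -> v = 0.
Proof.
move=> cd uw lt1 cv dv; apply/eqP; apply: contraT => v0; exfalso.
have [f [cf pf fv [g fg]]] := core_left_support cv.
have f0 : f != 0 by apply: contraNneq v0 => f0; rewrite -fv f0 amul0l.
have df : d ** f = f by rewrite fg amulA dv.
have [p [cp pp p0 le_pf pwp]] := cut_unbalanced pC uw cf pf f0.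
have fp := projection_leE pp pf le_pf.
have ppp : p ** (d - w) ** p = p.
  by rewrite amulBr amulBl pwp subr0 -amulA -fp (amulA d) df fp pp.2.
have zp : projection (zeta p).
  by case: pp => sp pp; split; rewrite -?(shom_star zhom) -?(shomM zhom) ?sp ?pp.
have n1 : `|zeta p| = 1.
  apply: norm_projection => //; apply: contraNneq p0 => zp0.
  by apply/eqP/zinj; rewrite zp0 (shom0 zhom).
have : `|zeta (p ** (d - w) ** p)| < 1.
  rewrite !(shomM zhom); apply: le_lt_trans (cstar_normM _ _) _.
  rewrite n1 mulr1; apply: le_lt_trans (cstar_normM _ _) _.
  by rewrite n1 mul1r.
by rewrite ppp n1 ltxx.
Qed.

Lemma projection_closure_sandwich J e : J `<=` core I H ->
    core I H e -> projection e -> closure (zeta @` sandwich J) (zeta e) ->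
  sandwich J e.
Proof.
move=> JA ce [_ ee] /closureP/(_ 1 ltr01)[_ [l Jl <-]].
have [k [w [ck Jk uw ->]]] := sandwich_decomp pA JA Jl.
rewrite -(shomB zhom) opprD addrA; set d := e - k => lt1.
have iJ := sandwich_ideal J; have sJ := sandwich_subspace J.
have cd : core I H d by apply: subspaceB => //; exact: core_subspace.
have [p p0 dp] := locally_matricial_algebraic pB cd.
have [m [q q1 pE]] := multiplicity_XsubC p 1; rewrite p0 /= in q1.
(* Each factor ['X - 1] of the annihilating polynomial produces a core element fixed by [d]; this
   vanishes by [core_fixed_eq0], so all these factors cancel. *)
have dq : pact d q d = 0.
  move: dp; rewrite {}pE polyC1; elim: m => [|m IH]; first by rewrite mulr1.
  rewrite exprSr mulrA mulrBr mulr1 pactD pactMX -(scaleN1r (q * _)) pactZ.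
  rewrite scaleN1r => /eqP; rewrite subr_eq0 => /eqP h.
  by apply: IH; apply: (core_fixed_eq0 cd uw lt1 _ h); exact: core_pact.
(* Since [d] is [e] modulo the ideal and [pact d q d] is [0], the ideal contains [q.[1] *: e], where
   [q.[1]] is nonzero. *)
have : sandwich J (pact d q d - q.[1] *: e).
  apply: pact_modulo_ideal => //.
  by rewrite /d addrAC subrr add0r; exact: subspaceN.
rewrite dq sub0r => /(subspaceN sJ); rewrite opprK => /(subspaceZ (q.[1])^-1 sJ).
by rewrite scalerA mulVf ?scale1r.
Qed.

(** The right support [e = g ** x] lies in the closed ideal together with [x], and [x = x ** e], so
    the case of projections suffices. *)
Lemma core_closure_sandwich J x : closure (range zeta) = setT -> J `<=` core I H ->
  core I H x -> closure (zeta @` sandwich J) (zeta x) -> sandwich J x.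
Proof.
move=> dense JA cx clx.
have [|e [ce pe xe [g eg]]] := @core_right_support x.
  by apply: coreM => //; exact: core_star.
have iJ := sandwich_ideal J.
rewrite -xe; apply: ideal_amull => //; apply: projection_closure_sandwich => //.
have [icl _] := closure_image_ideal zhom dense iJ.
by rewrite eg (shomM zhom); exact: ideal_amull icl _.
Qed.

(** The witness is [p + e], with [e] the right support of [q - q ** p]; this support is orthogonal
    to [p] and satisfies [q ** e = q - q ** p]. *)
Lemma projection_join P p q : ideal setT P ->
    core I H p -> projection p -> P p -> core I H q -> projection q -> P q ->
  exists e, [/\ core I H e, projection e, P e, p ** e = p & q ** e = q].
Proof.
move=> iP cp [sp pp] Pp cq [sq qq] Pq; have sP : subspace P by case: iP.
pose y := q - q ** p.
have cy : core I H y by apply: subspaceB; [exact: core_subspace| |exact: coreM].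
have [|e [ce [se ee] ye [g eg]]] := @core_right_support y.
  by apply: coreM => //; exact: core_star.
have yp : y ** p = 0 by rewrite amulBl -amulA pp subrr.
have ep : e ** p = 0 by rewrite eg -amulA yp amul0r.
have pe : p ** e = 0 by rewrite -[LHS]starK starM sp se ep star0.
exists (p + e); split.
- by apply: subspaceD => //; exact: core_subspace.
- split; first by rewrite starD sp se.
  by rewrite amulDl !amulDr pp ee ep pe addr0 add0r.
- apply: subspaceD => //; rewrite eg; apply: ideal_amull => //.
  by apply: subspaceB => //; exact: ideal_amulr.
- by rewrite amulDr pp pe addr0.
- rewrite amulDr; have -> : q ** e = y.
    by rewrite -ye amulBl -amulA pe amul0r subr0.
  by rewrite addrC subrK.
Qed.

Lemma sandwich_unit J l : J `<=` core I H -> sandwich J l ->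
  exists e, [/\ core I H e, projection e, sandwich J e & l ** e = l].
Proof.
move=> JA; have iJ := sandwich_ideal J; have sJ := sandwich_subspace J.
apply: (@lspan_sub C X _ [set l | exists e, [/\ core I H e, projection e,
    sandwich J e & l ** e = l]]).
  split.
    exists 0; rewrite amul0l; split=> //; [exact: (core_subspace I H).1| |exact: sJ.1].
    by split; rewrite ?star0 ?amul0l.
  move=> a x y [p [cp pp Jp xp]] [q [cq pq Jq yq]].
  have [e [ce pe Je ppe qe]] := projection_join iJ cp pp Jp cq pq Jq.
  exists e; split=> //; rewrite amulDl amulZl -xp -yq -!amulA ppe qe.
  by [].
move=> z [x [j [y [xW Jj yW zE]]]].
have cj := JA _ Jj; have Jz : sandwich J z by apply: sub_lspan; exists x, j, y.
have [|e [ce pe ze [g eg]]] := @core_right_support z.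
  (* [star x ** x] is in the core, multiplication by core elements stays there, and conjugation by
     the word [y] preserves balance. *)
  have -> : star z ** z = star y ** (star j ** (star x ** x) ** j) ** y.
    by rewrite zE !starM !amulA.
  apply: word_conj_core => //; apply: coreM => //; apply: coreM => //.
    exact: core_star.
  exact: word_norm_core.
by exists e; split=> //; rewrite eg; exact: ideal_amull.
Qed.

Lemma closure_sandwich_unit J u (d : C) : J `<=` core I H ->
    closure (zeta @` sandwich J) u -> 0 < d ->
  exists v, [/\ closure (zeta @` sandwich J) v, `|v| <= 1 & `|u - u ** v| < d].
Proof.
move=> JA clu d0; have d2 : 0 < d / 2%:R by rewrite divr_gt0 ?ltr0n.
have [_ [l Jl <-] ul] := (closureP _ _).1 clu _ d2.
have [e [ce [se ee] Je le]] := sandwich_unit JA Jl.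
have n1 : `|zeta e| <= 1.
  by apply: norm_projection_le1; split; rewrite -?(shom_star zhom) -?(shomM zhom) ?se ?ee.
exists (zeta e); split=> //; first by apply: subset_closure; exists e.
(* The local unit of the nearby element [l] serves for [u]: both terms are at most the distance from
   [u] to [zeta l]. *)
have -> : u - u ** zeta e = (u - zeta l) - (u - zeta l) ** zeta e.
  by rewrite amulBl -(shomM zhom) le opprB subrKA.
apply: le_lt_trans (ler_normB _ _) _; rewrite (splitr d); apply: ltrD => //.
by apply: le_lt_trans (cstar_normM _ _) _; apply: le_lt_trans ul; rewrite ler_piMr.
Qed.

End CuntzKrieger.

(** * Ideals of [B] and the closed ideals they generate *)

Theorem theorem4p6 (R : realType) (A : choiceType)
    (I : starIdeal (freeAlg R[i] A)) (H : torusSubgroup R[i] A)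
    (U : cstarAlgType R[i]) (zeta : quot I -> U) (B : set (quot I)) :
  CK_system I H ->
  universal_rep zeta ->
  injective zeta ->
  star_subalgebra B ->
  B `<=` core I H ->
  [/\ (forall J, Sigma_sub B J -> closed_ideal (Phi zeta J))
        /\ set_inj (Sigma_sub B) (Phi zeta),
      forall J, Sigma_sub B J -> zeta @^-1` (Phi zeta J) `&` B = J,
      forall D, (Phi zeta @` Sigma_sub B) D ->
        Sigma_sub B (zeta @^-1` D `&` B) /\ Phi zeta (zeta @^-1` D `&` B) = D,
      forall J K, Sigma_sub B J -> Sigma_sub B K ->
        Sigma_sub B (set_sum J K) ->
        Phi zeta (set_sum J K) = set_sum (Phi zeta J) (Phi zeta K)
    & forall J K, Sigma_sub B J -> Sigma_sub B K ->
        (Phi zeta @` Sigma_sub B) (Phi zeta J `&` Phi zeta K) ->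
        Phi zeta (J `&` K) = Phi zeta J `&` Phi zeta K].
Proof.
move=> [pA pB pC _] univ zinj subB BA.
have [zhom _] := univ; have dense := universal_rep_dense univ.
have sub_core J : Sigma_sub B J -> J `<=` core I H by move=> [J' _ <-] x [_ /BA].
have J0 J : Sigma_sub B J -> J 0.
  by move=> [J' [[_ [J'0 _] _] _] <-]; split=> //; case: subB => -[].
have PhiE J : Sigma_sub B J -> Phi zeta J = closure (zeta @` sandwich J).
  move=> /sub_core JA; apply: Phi_closure => //; first exact: sandwich_ideal.
    exact: (sub_sandwich pA pB zhom zinj JA).
  by move=> P; exact: sandwich_min.
have PhiI J : Sigma_sub B J -> closed_ideal (Phi zeta J).
  by move=> hJ; rewrite PhiE //; apply: closure_image_ideal => //; exact: sandwich_ideal.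
have PhiK J : Sigma_sub B J -> zeta @^-1` (Phi zeta J) `&` B = J.
  move=> hJ; have JA := sub_core _ hJ; apply/seteqP; split=> x.
    move=> [/= + Bx]; rewrite PhiE // => clx.
    have := core_closure_sandwich pA pB pC zhom zinj dense JA (BA _ Bx) clx.
    (* As [J] is the trace on [B] of an ideal [J'], the ideal it generates stays inside [J'] and so
       meets [B] only in [J]. *)
    move: hJ clx => [J' [iJ' _] <-] _ sx; split=> //.
    by apply: sandwich_min sx => // y [].
  by move=> Jx; split; [exact: sub_Phi|move: hJ Jx => [J' _ <-] []].
have PhiInj : set_inj (Sigma_sub B) (Phi zeta).
  move=> J K /set_mem hJ /set_mem hK eqP.
  by rewrite -(PhiK _ hJ) -(PhiK _ hK) eqP.
split=> //.
- by move=> _ [J hJ <-]; rewrite PhiK.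
- move=> J K hJ hK hJK; have [iJ cJ] := PhiI _ hJ; have [iK cK] := PhiI _ hK.
  have sJ : subspace (Phi zeta J) by case: iJ.
  have sK : subspace (Phi zeta K) by case: iK.
  apply/seteqP; split.
    apply: Phi_min; last first.
      move=> _ [x Jx [y Ky <-]]; rewrite /= (shomD zhom).
      by exists (zeta x); [exact: sub_Phi|exists (zeta y) => //; exact: sub_Phi].
    split; last first.
      (* The approximate units come from the core projections that are local units of
         [sandwich J]. *)
      apply: closed_set_sum => // i; rewrite PhiE // => cli d d0.
      exact: (closure_sandwich_unit pA pB zhom zinj (sub_core _ hJ) cli d0).
    split=> // [|b _ _ [x Jx [y Ky <-]]].
      split; first by exists 0; [case: sJ|exists 0; [case: sK|rewrite addr0]].
      move=> a _ _ [x Jx [y Ky <-]] [x' Jx' [y' Ky' <-]].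
      exists (a *: x + x'); first exact: sJ.2.
      by exists (a *: y + y'); [exact: sK.2|rewrite scalerDr addrACA].
    split.
      exists (b ** x); first exact: ideal_amull iJ Jx.
      by exists (b ** y); [exact: ideal_amull iK Ky|rewrite amulDr].
    exists (x ** b); first exact: ideal_amulr iJ Jx.
    by exists (y ** b); [exact: ideal_amulr iK Ky|rewrite amulDl].
  move=> _ [u Ju [v Kv <-]]; have [[_ sJK _] _] := PhiI _ hJK.
  apply: (subspaceD sJK).
    apply: PhiS Ju => x Jx; exists x => //; exists 0; rewrite ?addr0 //; exact: J0.
  by apply: PhiS Kv => x Kx; exists 0; [exact: J0|exists x => //; rewrite add0r].
(* If the intersection is generated by [M], then intersecting its preimage with [B] recovers both
   [M] and the intersection of [J] and [K]. *)
- move=> J K hJ hK [M hM eM]; rewrite -eM; congr Phi.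
  rewrite -(PhiK _ hM) -{1}(PhiK _ hJ) -{1}(PhiK _ hK) eM setIACA setIid.
  by rewrite preimage_setI.
Qed.
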